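(* Let $k$ be a field and let $\Delta$ be a $d$-dimensional normal pseudomanifold, $d\ge 1$, such that $\widetilde H^d(\Delta;k)\neq 0$, with facets $\sigma_1,\dots,\sigma_l$. Let $A,B$ be a partition of $\{1,\dots,l\}$ into two nonempty sets, let $\Delta_A$ be the simplicial complex with facets $\sigma_i$, $i\in A$, and let $\Delta_B$ be the simplicial complex with facets $\sigma_i$, $i\in B$. If $\Delta_A$ is Buchsbaum over $k$, then there is a long exact sequence \[0\to\widetilde H^0(\Delta_B;k)\to\widetilde H_{d-1}(\Delta_A;k)\to\widetilde H^1(\Delta;k)\to\widetilde H^1(\Delta_B;k)\to\widetilde H_{d-2}(\Delta_A;k)\to\widetilde H^2(\Delta;k)\to\cdots\to\widetilde H^{d-2}(\Delta_B;k)\to\widetilde H_1(\Delta_A;k)\to\widetilde H^{d-1}(\Delta;k)\to\widetilde H^{d-1}(\Delta_B;k)\to\widetilde H_0(\Delta_A;k)\to 0.\] Moreover, $\widetilde H^i(\mathrm{lk}_{\Delta_B}\sigma;k)\cong\widetilde H^i(\mathrm{lk}_\Delta\sigma;k)$ for all nonempty $\sigma\in\Delta$ and all $i<\dim\mathrm{lk}_\Delta\sigma=d-|\sigma|$. In particular, $\widetilde H^i(\mathrm{lk}_\Delta\sigma;k)=0$ for every $\sigma\in\Delta\setminus\Delta_B$ and all $i<\dim\mathrm{lk}_\Delta\sigma$.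
   Context: For a face $\sigma$ of a simplicial complex $\Delta$, $\dim\sigma=|\sigma|-1$ (an $i$-face is a face of dimension $i$), $\dim\Delta=\max_{\sigma\in\Delta}\dim\sigma$, and $\mathrm{lk}_\Delta\sigma=\{\tau\in\Delta:\tau\cup\sigma\in\Delta,\ \tau\cap\sigma=\emptyset\}$. Facets are the inclusion-maximal faces; $\Delta$ is pure $d$-dimensional if all facets have dimension $d$. A pure $d$-dimensional simplicial complex $\Delta$ is a normal pseudomanifold if (i) $\mathrm{lk}_\Delta(\sigma)$ is connected for every $i$-face $\sigma$ with $i\le d-2$ (including the empty face, of dimension $-1$, when $-1\le d-2$), and (ii) every $(d-1)$-face is contained in exactly two $d$-faces. A simplicial complex $\Gamma$ is Buchsbaum over $k$ if, for all nonempty $\sigma\in\Gamma$, $\widetilde H_i(\mathrm{lk}_\Gamma\sigma;k)=0$ for all $i<\dim\mathrm{lk}_\Gamma\sigma$. If $\sigma\notin\Delta_B$, then $\mathrm{lk}_{\Delta_B}\sigma$ is the void complex (no faces at all), all of whose reduced cohomology is $0$; the complex $\{\emptyset\}$ has $\widetilde H^{-1}(\{\emptyset\};k)=k$. For $d=1$ the long exact sequence reads $0\to\widetilde H^0(\Delta_B;k)\to\widetilde H_0(\Delta_A;k)\to 0$. *)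

(* Defs.v *)
From HB Require Import structures.
From mathcomp Require Import all_boot all_order all_algebra.
From mathcomp Require Import generic_quotient.

Set Implicit Arguments.
Unset Strict Implicit.
Unset Printing Implicit Defensive.

Import Order.TTheory GRing.Theory Num.Theory.

Local Open Scope ring_scope.

Section QuotientSpace.

Local Open Scope quotient_scope.

Variables (K : fieldType) (vT : vectType K) (U : {vspace vT}).

Definition vquot_equiv (x y : vT) : bool := x - y \in U.

Lemma vquot_equiv_is_equiv : equiv_class_of vquot_equiv.
Proof.
split=> [x|x y|y x z]; rewrite /vquot_equiv.
- by rewrite subrr mem0v.
- by rewrite -memvN opprB.
- by move=> xy yz; rewrite -(subrKA y) memvD.
Qed.

Canonical vquot_equivRel := EquivRelPack vquot_equiv_is_equiv.

Definition vquot := {eq_quot vquot_equivRel}.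

HB.instance Definition _ := Choice.on vquot.
HB.instance Definition _ := EqQuotient.on vquot.

Lemma vquotW (P : vquot -> Prop) :
  (forall x : vT, P (\pi_vquot x)) -> forall x : vquot, P x.
Proof. by move=> Ppi x; rewrite -[x]reprK; apply: Ppi. Qed.

Lemma vquot_piE (x y : vT) : (\pi_vquot x == \pi_vquot y) = (x - y \in U).
Proof. exact: eqmodE. Qed.

Lemma vquot_reprP (x : vT) : repr (\pi_vquot x) - x \in U.
Proof. by rewrite -vquot_piE reprK. Qed.

Definition vquot_zero : vquot := \pi_vquot 0.
Definition vquot_add (x y : vquot) : vquot := \pi_vquot (repr x + repr y).
Definition vquot_opp (x : vquot) : vquot := \pi_vquot (- repr x).
Definition vquot_scale (a : K) (x : vquot) : vquot := \pi_vquot (a *: repr x).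

Lemma vquot_piD (x y : vT) :
  vquot_add (\pi_vquot x) (\pi_vquot y) = \pi_vquot (x + y).
Proof.
by apply/eqP; rewrite vquot_piE opprD addrACA memvD ?vquot_reprP.
Qed.

Lemma vquot_piN (x : vT) : vquot_opp (\pi_vquot x) = \pi_vquot (- x).
Proof. by apply/eqP; rewrite vquot_piE -opprD memvN vquot_reprP. Qed.

Lemma vquot_piZ a (x : vT) : vquot_scale a (\pi_vquot x) = \pi_vquot (a *: x).
Proof. by apply/eqP; rewrite vquot_piE -scalerBr memvZ ?vquot_reprP. Qed.

Fact vquot_addA : associative vquot_add.
Proof.
elim/vquotW=> x; elim/vquotW=> y; elim/vquotW=> z.
by rewrite !vquot_piD addrA.
Qed.
Fact vquot_addC : commutative vquot_add.
Proof.
by elim/vquotW=> x; elim/vquotW=> y; rewrite !vquot_piD addrC.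
Qed.
Fact vquot_add0 : left_id vquot_zero vquot_add.
Proof. by elim/vquotW=> x; rewrite vquot_piD add0r. Qed.
Fact vquot_addN : left_inverse vquot_zero vquot_opp vquot_add.
Proof. by elim/vquotW=> x; rewrite vquot_piN vquot_piD addNr. Qed.

HB.instance Definition _ := GRing.isZmodule.Build vquot
  vquot_addA vquot_addC vquot_add0 vquot_addN.

Fact vquot_scaleA a b x : vquot_scale a (vquot_scale b x) = vquot_scale (a * b) x.
Proof. by elim/vquotW: x => x; rewrite !vquot_piZ scalerA. Qed.
Fact vquot_scale1 : left_id 1 vquot_scale.
Proof. by elim/vquotW=> x; rewrite vquot_piZ scale1r. Qed.
Fact vquot_scaleDr : right_distributive vquot_scale +%R.
Proof.
move=> a; elim/vquotW=> x; elim/vquotW=> y.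
by rewrite [\pi_vquot x + _]vquot_piD !vquot_piZ [RHS]vquot_piD scalerDr.
Qed.
Fact vquot_scaleDl x : {morph vquot_scale^~ x : a b / a + b}.
Proof.
move=> a b; elim/vquotW: x => x.
by rewrite !vquot_piZ [RHS]vquot_piD scalerDl.
Qed.

HB.instance Definition _ := GRing.Zmodule_isLmodule.Build K vquot
  vquot_scaleA vquot_scale1 vquot_scaleDr vquot_scaleDl.

Fact vquot_pi_is_linear : linear (\pi_vquot : vT -> vquot).
Proof. by move=> a x y; rewrite -vquot_piD -vquot_piZ. Qed.

HB.instance Definition _ :=
  GRing.isLinear.Build K vT vquot _ \pi_vquot vquot_pi_is_linear.

End QuotientSpace.

(* ker g / (im f :&: ker g), i.e. the usual ker g / im f when g \o f = 0. *)
Definition homology_at (K : fieldType) (U V W : vectType K)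
    (f : 'Hom(U, V)) (g : 'Hom(V, W)) : lmodType K :=
  vquot ((linfun (vsval : subvs_of (lker g) -> V)) @^-1: limg f)%VS.

Section SimplicialComplexes.

Variable V : finType.

(* The void complex (no faces) is allowed and differs from {set0}. *)
Record simplicial_complex := SimplicialComplex {
  faces :> {set {set V}};
  faces_closed : forall s t : {set V}, s \in faces -> t \subset s -> t \in faces
}.

Implicit Type D : simplicial_complex.

Definition fdim (s : {set V}) : int := #|s|%:Z - 1.

(* Meaningful for nonvoid complexes; the value is -1 on the void one. *)
Definition cdim D : int := (\max_(s in faces D) #|s|)%:Z - 1.

Definition facets D : {set {set V}} :=
  [set s in faces D | [forall t in faces D, (s \subset t) ==> (t == s)]].

Definition link_faces D (s : {set V}) : {set {set V}} :=
  [set t in faces D | (t :|: s \in faces D) && (t :&: s == set0)].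

Fact link_closed D s (t u : {set V}) :
  t \in link_faces D s -> u \subset t -> u \in link_faces D s.
Proof.
rewrite !inE => /and3P[tD tsD /eqP ts0] ut; apply/and3P; split.
- exact: faces_closed tD ut.
- by apply: faces_closed tsD _; apply: setSU.
- by rewrite -subset0 -ts0 setSI.
Qed.

Definition link D s := SimplicialComplex (@link_closed D s).

Definition gen_faces (F : {set {set V}}) : {set {set V}} :=
  [set t : {set V} | [exists s in F, t \subset s]].

Fact gen_closed F (t u : {set V}) :
  t \in gen_faces F -> u \subset t -> u \in gen_faces F.
Proof.
rewrite !inE => /exists_inP[s sF ts] ut.
by apply/exists_inP; exists s => //; apply: subset_trans ut ts.
Qed.

Definition generated_complex F := SimplicialComplex (@gen_closed F).

Definition adjacent D : rel V := [rel x y | [set x; y] \in faces D].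

Definition connected_complex D : Prop :=
  forall x y : V, [set x] \in faces D -> [set y] \in faces D ->
    connect (adjacent D) x y.

Definition pure_of_dim (d : nat) D : Prop :=
  cdim D = d%:Z /\ forall s, s \in facets D -> fdim s = d%:Z.

Definition normal_pseudomanifold (d : nat) D : Prop :=
  [/\ pure_of_dim d D,
      forall s, s \in faces D -> fdim s <= d%:Z - 2 ->
        connected_complex (link D s)
    & forall s, s \in faces D -> fdim s = d%:Z - 1 ->
        #|[set t in faces D | (fdim t == d%:Z) && (s \subset t)]| = 2].

Variable K : fieldType.

(* Faces are oriented by the order of [enum V]: for s = v |: t with v outside
   t, the incidence number is (-1)^j, where v is the j-th element (from 0) of s. *)
Definition incidence (s t : {set V}) : K :=
  \sum_(v | (v \notin t) && (s == v |: t))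
    (-1) ^+ #|[set u in t | (enum_rank u < enum_rank v)%N]|.

Definition face_of_dim D (i : int) :=
  {s : {set V} | (s \in faces D) && (fdim s == i)}.

(* Both the i-chains and the i-cochains, in coordinates with respect to the
   basis of i-faces, respectively its dual basis. *)
Definition chain D (i : int) := {ffun face_of_dim D i -> K^o}.

Definition bd_fun D (i j : int) (c : chain D i) : chain D j :=
  [ffun t : face_of_dim D j => \sum_s incidence (val s) (val t) * c s].

Definition cobd_fun D (i j : int) (c : chain D i) : chain D j :=
  [ffun s : face_of_dim D j => \sum_t incidence (val s) (val t) * c t].

Fact bd_is_linear D i j : linear (@bd_fun D i j).
Proof.
move=> a c e; apply/ffunP => t; rewrite !ffunE scaler_sumr -big_split /=.
by apply: eq_bigr => s _; rewrite !ffunE mulrDr scalerAr.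
Qed.

Fact cobd_is_linear D i j : linear (@cobd_fun D i j).
Proof.
move=> a c e; apply/ffunP => t; rewrite !ffunE scaler_sumr -big_split /=.
by apply: eq_bigr => s _; rewrite !ffunE mulrDr scalerAr.
Qed.

HB.instance Definition _ D i j :=
  GRing.isLinear.Build K (chain D i) (chain D j) _ (@bd_fun D i j)
    (@bd_is_linear D i j).
HB.instance Definition _ D i j :=
  GRing.isLinear.Build K (chain D i) (chain D j) _ (@cobd_fun D i j)
    (@cobd_is_linear D i j).

(* Only used for j = i - 1, respectively j = i + 1; keeping j free avoids
   casts between chain D (i + 1 - 1) and chain D i. *)
Definition bd D (i j : int) : 'Hom(chain D i, chain D j) :=
  linfun (@bd_fun D i j).
Definition cobd D (i j : int) : 'Hom(chain D i, chain D j) :=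
  linfun (@cobd_fun D i j).

(* Reduced (co)homology: the empty face is a face of dimension -1. *)
Definition redH D (i : int) : lmodType K :=
  homology_at (bd D (i + 1) i) (bd D i (i - 1)).
Definition redcoH D (i : int) : lmodType K :=
  homology_at (cobd D (i - 1) i) (cobd D i (i + 1)).

Definition buchsbaum D : Prop :=
  forall s, s \in faces D -> s != set0 ->
  forall i : int, i < cdim (link D s) ->
  forall x : redH (link D s) i, x = 0.

End SimplicialComplexes.

Arguments redH {V} K D i.
Arguments redcoH {V} K D i.
Arguments buchsbaum {V} K D.

Definition exact (X Y Z : zmodType) (f : X -> Y) (g : Y -> Z) : Prop :=
  forall y : Y, g y = 0 <-> exists x : X, f x = y.

Definition lin_isomorphic (K : fieldType) (X Y : lmodType K) : Prop :=
  exists f : {linear X -> Y}, bijective f.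

(* Main.v *)
Require Import Defs.
From HB Require Import structures.
From mathcomp Require Import all_boot all_order all_algebra.
From mathcomp Require Import generic_quotient zify ring.

(* The long exact sequence is that of the pair (Delta, Delta_B), once the
   relative cohomology H^j(Delta, Delta_B) is identified with the homology of
   Delta_A in degree d - j; at j = d the identification holds up to one
   dimension, which accounts for H^d(Delta) = k.  To see this, let rho be a
   common face of Delta_A and Delta_B and consider the pairs (s, t) of faces of
   Delta_A with rho <= s <= t, the differential raising s and lowering t, to
   which we add a pair (s, None) for every s >= rho in Delta but not in Delta_B,
   where None is a formal (d+1)-cell bounded by the fundamental cycle of Delta.
   For fixed s different from rho the complex in t is acyclic: below the top
   degree because Delta_A is Buchsbaum, and in the top degree because the facets
   of Delta above s are strongly connected, so that top cycles above s are
   multiples of the fundamental cycle.  Hence only the column s = rho, the star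
   of rho in Delta_A, contributes.  For fixed t different from rho and None the
   complex in s is a Boolean interval, hence acyclic, and the row t = None is the
   relative cochain complex.
   Taking rho empty gives the sequence; taking rho nonempty, and noting that
   stars compute the homology of links, gives the statement on links.
   All spaces being finite dimensional, the argument is carried out on Betti
   numbers, where homology and cohomology have the same dimension. *)

Set Implicit Arguments.
Unset Strict Implicit.
Unset Printing Implicit Defensive.

Import Order.TTheory GRing.Theory Num.Theory.

Local Open Scope ring_scope.

(** * Ranks of submatrices *)

Section SubMatrix.

Variable K : fieldType.

(* Padded with zeros, so that no cast is needed between index types. *)
Definition smx (I J : finType) (D : I -> J -> K) (a : {set I}) (b : {set J}) :
    'M[K]_(#|I|, #|J|) :=
  \matrix_(i, j) if (enum_val i \in a) && (enum_val j \in b)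
                 then D (enum_val i) (enum_val j) else 0.

Definition kdelta (I : finType) (x y : I) : K := (x == y)%:R.

Lemma eq_smx (I J : finType) (D E : I -> J -> K)
    (a a' : {set I}) (b b' : {set J}) :
  (forall x y, (if (x \in a) && (y \in b) then D x y else 0) =
               (if (x \in a') && (y \in b') then E x y else 0)) ->
  smx D a b = smx E a' b'.
Proof. by move=> DE; apply/matrixP=> i j; rewrite !mxE. Qed.

Lemma smx_mul (I J L : finType) (D : I -> J -> K) (E : J -> L -> K)
    (a : {set I}) (b : {set J}) (c : {set L}) :
  smx D a b *m smx E b c = smx (fun x z => \sum_(y in b) D x y * E y z) a c.
Proof.
apply/matrixP=> i j; rewrite !mxE.
have enumB : {on [pred y | y \in b], bijective (@enum_val J J)}.
  by apply: onW_bij; exists enum_rank; [apply: enum_valK | apply: enum_rankK].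
rewrite (reindex _ enumB) /=.
case: (boolP (enum_val i \in a)) => ia /=; last first.
  by rewrite big1 // => l _; rewrite !mxE (negPf ia) mul0r.
case: (boolP (enum_val j \in c)) => jc /=; last first.
  by rewrite big1 // => l _; rewrite !mxE (negPf jc) andbF mulr0.
rewrite (bigID (fun l => enum_val l \in b)) /= addrC big1 ?add0r => [|l lb].
  by apply: eq_bigr => l lb; rewrite !mxE ia jc lb.
by rewrite !mxE (negPf lb) andbF mul0r.
Qed.

Lemma smx_tr (I J : finType) (D : I -> J -> K)
    (a : {set I}) (b : {set J}) :
  (smx D a b)^T = smx (fun y x => D x y) b a.
Proof. by apply/matrixP=> i j; rewrite !mxE andbC. Qed.

Lemma rank_smx_tr (I J : finType) (D : I -> J -> K)
    (a : {set I}) (b : {set J}) :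
  \rank (smx (fun y x => D x y) b a) = \rank (smx D a b).
Proof. by rewrite -smx_tr mxrank_tr. Qed.

Lemma smx0 (I J : finType) (D : I -> J -> K)
    (a : {set I}) (b : {set J}) :
  (forall x y, x \in a -> y \in b -> D x y = 0) -> smx D a b = 0.
Proof.
move=> D0; apply/matrixP=> i j; rewrite !mxE.
by case: ifP => // /andP[ia jb]; rewrite D0.
Qed.

(** Multiplication by padded identities selects rows and columns, so rank statements about blocks
    become statements about products. *)
Lemma smx_restr (I J : finType) (D : I -> J -> K)
    (a a' : {set I}) (b b' : {set J}) :
  a \subset a' -> b \subset b' ->
  smx (@kdelta I) a a' *m smx D a' b' *m smx (@kdelta J) b' b = smx D a b.
Proof.
move=> aa' bb'; rewrite !smx_mul; apply: eq_smx => x y.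
case: ifP => // /andP[xa yb].
have [xa' yb'] := (subsetP aa' x xa, subsetP bb' y yb).
rewrite (bigD1 y) //= [X in _ + X]big1 => [|z /andP[_ zy]]; last first.
  by rewrite /kdelta (negPf zy) mulr0.
rewrite (bigD1 x) //= big1 => [|z /andP[_ zx]].
  by rewrite /kdelta !eqxx mul1r mulr1 !addr0.
by rewrite /kdelta eq_sym (negPf zx) mul0r.
Qed.

Lemma rank_smxS (I J : finType) (D : I -> J -> K)
    (a a' : {set I}) (b b' : {set J}) :
  a \subset a' -> b \subset b' ->
  (\rank (smx D a b) <= \rank (smx D a' b'))%N.
Proof.
move=> aa' bb'; rewrite -(smx_restr _ aa' bb').
exact: leq_trans (mxrankM_maxl _ _) (mxrankM_maxr _ _).
Qed.

(** The matrix has [#|I|] rows because of the padding; the bound comes from factoring it through the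
    [#|a|] rows that matter. *)
Lemma rank_smx_le (I J : finType) (D : I -> J -> K)
    (a : {set I}) (b : {set J}) :
  (\rank (smx D a b) <= #|a|)%N.
Proof.
pose s : 'M[K]_(#|I|, #|a|) := \matrix_(i, j) (enum_val i == enum_val j)%:R.
have -> : smx D a b = s *m \matrix_(i, j) smx D a b (enum_rank (enum_val i)) j.
  apply/matrixP=> i j; rewrite !mxE; case: (boolP (enum_val i \in a)) => ia.
    rewrite (bigD1 (enum_rank_in ia (enum_val i))) //= !mxE enum_rankK_in //.
    rewrite !enum_rankK eqxx mul1r ia big1 ?addr0 // => l li.
    rewrite !mxE; case: eqP => [il|_]; last by rewrite mul0r.
    by case/eqP: li; apply: enum_val_inj; rewrite enum_rankK_in.
  rewrite big1 // => l _; rewrite !mxE; case: eqP => [il|_]; rewrite ?mul0r //.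
  by rewrite il enum_valP in ia.
exact: leq_trans (mxrankM_maxl _ _) (rank_leq_col _).
Qed.

Lemma rank_kdelta (I : finType) (a : {set I}) :
  \rank (smx (@kdelta I) a a) = #|a|.
Proof.
apply/eqP; rewrite eqn_leq rank_smx_le /=.
(* The identities on [a] and on its complement sum to [1%:M], so subadditivity of the rank forces
   both upper bounds to be attained. *)
have Ia : smx (@kdelta I) a a + smx (@kdelta I) (~: a) (~: a) = 1%:M.
  apply/matrixP=> i j; rewrite !mxE /kdelta (inj_eq enum_val_inj) !in_setC.
  case: eqP => [->|_]; last by rewrite !if_same addr0.
  by rewrite !andbb; case: (_ \in a); rewrite ?addr0 ?add0r.
have := mxrank_add (smx (@kdelta I) a a) (smx (@kdelta I) (~: a) (~: a)).
rewrite Ia mxrank1 => le; rewrite -(leq_add2r #|~: a|) cardsC.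
by apply: leq_trans le _; rewrite leq_add2l rank_smx_le.
Qed.

Lemma rank_smx_le2 (I J : finType) (D : I -> J -> K)
    (a : {set I}) (b : {set J}) :
  (\rank (smx D a b) <= #|b|)%N.
Proof. by rewrite -rank_smx_tr rank_smx_le. Qed.

(** Frobenius' inequality with the identity on [b] as middle factor. If the composite vanishes, it
    bounds the ranks of two consecutive differentials by [#|b|]. *)
Lemma rank_smx_Frobenius (I J L : finType) (D : I -> J -> K) (E : J -> L -> K)
    (a : {set I}) (b : {set J}) (c : {set L}) :
  (\rank (smx D a b) + \rank (smx E b c) <=
     #|b| + \rank (smx (fun x z => \sum_(y in b) D x y * E y z)%R a c))%N.
Proof.
have := mxrank_Frobenius (smx D a b) (smx (@kdelta J) b b) (smx E b c).
have -> : smx D a b *m smx (@kdelta J) b b = smx D a b.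
  rewrite smx_mul; apply: eq_smx => x y; case: ifP => // /andP[xa yb].
  rewrite (bigD1 y) //= big1 => [|z /andP[_ zy]].
    by rewrite /kdelta eqxx mulr1 addr0.
  by rewrite /kdelta (negPf zy) mulr0.
have -> : smx (@kdelta J) b b *m smx E b c = smx E b c.
  rewrite smx_mul; apply: eq_smx => x y; case: ifP => // /andP[xa yb].
  rewrite (bigD1 x) //= big1 => [|z /andP[_ zy]].
    by rewrite /kdelta eqxx mul1r addr0.
  by rewrite /kdelta eq_sym (negPf zy) mul0r.
by rewrite rank_kdelta smx_mul.
Qed.

(** Apply Frobenius' inequality to [M] between the selections of the rows [a'] and of the columns
    [b]: the triple product is the zero block, and each outer product has at least the rank of a
    diagonal block. *)
Lemma rank_smx_trig (I J : finType) (D : I -> J -> K)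
    (a a' : {set I}) (b b' : {set J}) :
  (forall x y, x \in a' -> y \in b -> D x y = 0) ->
  (\rank (smx D a b) + \rank (smx D a' b') <=
     \rank (smx D (a :|: a') (b :|: b')))%N.
Proof.
move=> D0; set M := smx D (a :|: a') (b :|: b').
have := mxrank_Frobenius (smx (@kdelta I) a' (a :|: a')) M
          (smx (@kdelta J) (b :|: b') b).
rewrite (smx_restr D (subsetUr a a') (subsetUl b b')).
rewrite (smx0 D0) mxrank0 addn0.
rewrite -{1}(smx_restr D (subsetUr a a') (subsetUr b b')).
rewrite -(smx_restr D (subsetUl a a') (subsetUl b b')) -/M.
apply: leq_trans; rewrite addnC; apply: leq_add; first exact: mxrankM_maxl.
by rewrite -mulmxA; apply: mxrankM_maxr.
Qed.

(** The identity on [a] cannot kill the whole left kernel: the kernel has dimension [#|I|] minus the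
    rank, and this would force the rank to be at least [#|a|]. So some kernel vector is visible on
    [a]. *)
Lemma smx_kernel (I J : finType) (D : I -> J -> K)
    (a : {set I}) (b : {set J}) :
  (\rank (smx D a b) < #|a|)%N ->
  exists f : I -> K, (exists2 x, x \in a & f x != 0) /\
    forall y, y \in b -> \sum_(x in a) f x * D x y = 0.
Proof.
set M := smx D a b => rM.
have : kermx M *m smx (@kdelta I) a a != 0.
  apply: contraTneq rM => k0; have := mulmx0_rank_max k0.
  rewrite rank_kdelta mxrank_ker; have := rank_leq_row M; lia.
case/matrix0Pn => i [j nz].
pose f x := kermx M i (enum_rank x).
have fE (L : finType) (E : I -> L -> K) c l :
    (kermx M *m smx E a c) i l =
      if enum_val l \in c then \sum_(x in a) f x * E x (enum_val l) else 0.
  rewrite mxE; have enumB : {on [pred y | y \in a], bijective (@enum_val I I)}.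
    by apply: onW_bij; exists enum_rank; [apply: enum_valK|apply: enum_rankK].
  rewrite (reindex _ enumB) /=.
  rewrite (bigID (fun l => enum_val l \in a)) /= [X in _ + X]big1 ?addr0.
    case: ifP => lc; last first.
      by apply: big1 => x xa; rewrite [smx _ _ _ _ _]mxE xa lc mulr0.
    by apply: eq_bigr => x xa; rewrite /f [smx _ _ _ _ _]mxE xa lc enum_valK.
  by move=> x xa; rewrite [smx _ _ _ _ _]mxE (negPf xa) mulr0.
exists f; split.
  rewrite fE in nz; case: ifP nz => [ja nz|]; last by rewrite eqxx.
  exists (enum_val j) => //; apply: contraNneq nz => fj.
  rewrite (bigD1 (enum_val j)) //= fj mul0r add0r big1 // => x /andP[_ xj].
  by rewrite /kdelta (negPf xj) mulr0.
move=> y yb; have := fE _ D b (enum_rank y); rewrite -/M mulmx_ker mxE.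
by rewrite enum_rankK yb.
Qed.

Lemma rank_smx_rows (I J : finType) (D : I -> J -> K)
    (a : {set I}) (b : {set J}) :
  (forall f : I -> K, (forall y, y \in b -> \sum_(x in a) f x * D x y = 0) ->
     forall x, x \in a -> f x = 0) -> \rank (smx D a b) = #|a|.
Proof.
move=> Df; apply/eqP; rewrite eqn_leq rank_smx_le /= leqNgt.
apply/negP=> /smx_kernel[f [[x xa fx] fD]].
by rewrite (Df f fD x xa) eqxx in fx.
Qed.

Lemma rank_smx_gt0 (I J : finType) (D : I -> J -> K)
    (a : {set I}) (b : {set J}) x y :
  x \in a -> y \in b -> D x y != 0 -> (0 < \rank (smx D a b))%N.
Proof.
move=> xa yb Dxy; rewrite lt0n mxrank_eq0; apply: contraNneq Dxy => /matrixP.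
by move/(_ (enum_rank x) (enum_rank y)); rewrite !mxE !enum_rankK xa yb => Dxy0; apply/eqP.
Qed.

(** The scalings [e] and [e'] absorb changes of orientation. Each matrix is a product with the other
    as middle factor, which gives both inequalities. *)
Lemma rank_smx_reindex (I J I' J' : finType) (D : I -> J -> K)
    (D' : I' -> J' -> K) (p : I -> I') (q : J -> J') (e : I -> K) (e' : J -> K)
    (a : {set I}) (b : {set J}) :
  {in a &, injective p} -> {in b &, injective q} ->
  (forall x, x \in a -> e x != 0) -> (forall y, y \in b -> e' y != 0) ->
  (forall x y, x \in a -> y \in b -> D' (p x) (q y) = e x * e' y * D x y) ->
  \rank (smx D' (p @: a) (q @: b)) = \rank (smx D a b).
Proof.
move=> pI qI e0 e0' DD.
apply/eqP; rewrite eqn_leq; apply/andP; split.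
  pose R := smx (fun x' x => (x' == p x)%:R * e x : K) (p @: a) a.
  pose S := smx (fun y y' => (y' == q y)%:R * e' y : K) b (q @: b).
  suff -> : smx D' (p @: a) (q @: b) = R *m smx D a b *m S.
    exact: leq_trans (mxrankM_maxl _ _) (mxrankM_maxr _ _).
  rewrite !smx_mul; apply: eq_smx => x' y'; case: ifP => //.
  case/andP=> /imsetP[x xa ->] /imsetP[y yb ->].
  rewrite (bigD1 y) //= [X in _ + X]big1 => [|z /andP[zb zy]]; last first.
    by rewrite (inj_in_eq qI) // eq_sym (negPf zy) mul0r mulr0.
  rewrite addr0 (bigD1 x) //= [X in _ + X]big1 => [|z /andP[za zx]]; last first.
    by rewrite (inj_in_eq pI) // eq_sym (negPf zx) !mul0r.
  by rewrite !eqxx !mul1r addr0 DD // mulrAC.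
pose R := smx (fun x x' => (x' == p x)%:R / e x : K) a (p @: a).
pose S := smx (fun y' y => (y' == q y)%:R / e' y : K) (q @: b) b.
suff -> : smx D a b = R *m smx D' (p @: a) (q @: b) *m S.
  exact: leq_trans (mxrankM_maxl _ _) (mxrankM_maxr _ _).
rewrite !smx_mul; apply: eq_smx => x y; case: ifP => // /andP[xa yb].
have big_p (T : zmodType) (F : I' -> T) :
    \sum_(z in p @: a) F z = \sum_(z in a) F (p z) by rewrite big_imset.
have big_q (T : zmodType) (F : J' -> T) :
    \sum_(z in q @: b) F z = \sum_(z in b) F (q z) by rewrite big_imset.
rewrite big_q (bigD1 y) //= [X in _ + X]big1 => [|z /andP[zb zy]]; last first.
  by rewrite (inj_in_eq qI) // (negPf zy) mul0r mulr0.
rewrite addr0 big_p (bigD1 x) //= [X in _ + X]big1 => [|z /andP[za zx]]; last first.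
  by rewrite (inj_in_eq pI) // (negPf zx) !mul0r.
rewrite !eqxx !mul1r addr0 DD // !mulrA mulVf ?e0 // mul1r mulrAC.
by rewrite mulfV ?e0' ?mul1r.
Qed.

End SubMatrix.

(** * Betti numbers of based complexes *)

Section Betti.

Variables (K : fieldType) (I : finType) (D : I -> I -> K) (g : I -> int).
Implicit Types (X Z : {set I}) (n : int).

Definition lev X n : {set I} := [set x in X | g x == n].

Definition brank X n : nat := \rank (smx D (lev X n) (lev X (n - 1))).

(** For a complex the truncated subtractions are genuine, by [brank_add], and the value is cycles
    minus boundaries. *)
Definition betti X n : nat := (#|lev X n| - brank X n - brank X (n + 1))%N.

(** The sum runs over [X] only, so that one global [D] serves for every subcomplex and quotient cut
    out by a set of cells. *)
Definition is_complex X : Prop :=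
  (forall x y, x \in X -> y \in X -> D x y != 0 -> g x = g y + 1) /\
  (forall x z, x \in X -> z \in X -> \sum_(y in X) D x y * D y z = 0).

Lemma in_lev X n x : (x \in lev X n) = (x \in X) && (g x == n).
Proof. by rewrite inE. Qed.

Lemma lev_sum X x z n : is_complex X -> x \in X -> z \in X ->
  g x = n + 1 -> \sum_(y in lev X n) D x y * D y z = 0.
Proof.
case=> deg DD xX zX gx; rewrite -[RHS](DD x z xX zX).
rewrite [RHS](bigID (fun y => g y == n)) /= [X in _ = _ + X]big1 ?addr0.
  by apply: eq_bigl => y; rewrite in_lev.
move=> y /andP[yX gy]; have [->|Dxy] := eqVneq (D x y) 0; first by rewrite mul0r.
by case/eqP: gy; have := deg _ _ xX yX Dxy; rewrite gx => /addIr.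
Qed.

Lemma brank_succ X n : \rank (smx D (lev X (n + 1)) (lev X n)) = brank X (n + 1).
Proof. by rewrite /brank addrK. Qed.

Lemma brank_add X n : is_complex X ->
  (brank X n + brank X (n + 1) <= #|lev X n|)%N.
Proof.
move=> cX; rewrite -brank_succ addnC; apply: leq_trans (rank_smx_Frobenius _ _ _ _ _) _.
rewrite smx0 ?mxrank0 ?addn0 // => x z; rewrite !in_lev.
by move=> /andP[xX /eqP gx] /andP[zX _]; apply: lev_sum.
Qed.

Lemma bettiE X n : is_complex X ->
  (betti X n + brank X n + brank X (n + 1) = #|lev X n|)%N.
Proof. by move/(brank_add n); rewrite /betti; lia. Qed.

(** The square stays zero when no two-step path leaves [Z] and returns; this covers closed, open and
    convex sets of cells alike. *)
Lemma sub_complex X Z : is_complex X -> Z \subset X ->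
  (forall x y z, x \in Z -> z \in Z -> y \in X -> y \notin Z ->
     D x y * D y z = 0) -> is_complex Z.
Proof.
move=> [deg DD] /subsetP ZX conv; split=> [x y xZ yZ|x z xZ zZ].
  by apply: deg; apply: ZX.
rewrite -[RHS](DD x z (ZX _ xZ) (ZX _ zZ)) [RHS](bigID (mem Z)) /=.
rewrite [X in _ = _ + X]big1 ?addr0 => [|y /andP[yX yZ]]; last exact: conv.
by apply: eq_bigl => y; rewrite andbC; case: (boolP (y \in Z)) => // /ZX ->.
Qed.

(** * Long exact sequence of a subcomplex [Z] with quotient [U], by ranks *)

Section LongExactSequence.

Variables X Z : {set I}.
Hypotheses (cX : is_complex X) (ZX : Z \subset X).
Hypothesis DZ : forall x y, x \in Z -> y \in X :\: Z -> D x y = 0.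

Let U := X :\: Z.

Let in_U x : (x \in U) = (x \notin Z) && (x \in X).
Proof. by rewrite inE. Qed.

Lemma closed_complex : is_complex Z.
Proof.
apply: sub_complex cX ZX _ => x y z xZ zZ yX yZ.
by rewrite DZ ?mul0r // in_U yZ.
Qed.

Lemma open_complex : is_complex U.
Proof.
apply: sub_complex cX _ _ => [|x y z xU zU yX].
  by apply/subsetP=> x; rewrite in_U => /andP[].
by rewrite in_U yX andbT negbK => yZ; rewrite [D y z]DZ ?mulr0.
Qed.

Lemma lev_split n : lev X n = lev U n :|: lev Z n.
Proof.
apply/setP=> x; rewrite in_setU !in_lev in_U.
by case: (boolP (x \in Z)) => [/(subsetP ZX) ->|_]; rewrite ?orbF.
Qed.

Lemma card_lev_split n : #|lev X n| = (#|lev U n| + #|lev Z n|)%N.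
Proof.
rewrite lev_split cardsU; have -> : lev U n :&: lev Z n = set0.
  apply/setP=> x; rewrite in_setI !in_lev in_U in_set0.
  by case: (x \in Z); rewrite ?andbF.
by rewrite cards0 subn0.
Qed.

(* The rank of the connecting map H_n(X, Z) -> H_(n - 1)(Z). *)
Definition crank n : nat := (brank X n - brank U n - brank Z n)%N.

Lemma brank_split_ge n : (brank U n + brank Z n <= brank X n)%N.
Proof.
rewrite /brank !lev_split; apply: rank_smx_trig => x y.
by rewrite !in_lev => /andP[xZ _] /andP[yU _]; apply: DZ.
Qed.

(** Bounds the connecting rank by the homology of the quotient. In Frobenius' inequality [E] stacks
    the differential on [lev U (n + 1)] and the identity on [lev Z n]; as the square is zero, its
    product with [D] retains only the differential of [Z]. *)
Lemma brank_split_le1 n :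
  (brank X n + brank U (n + 1) <= #|lev U n| + brank Z n)%N.
Proof.
pose E x y := if x \in Z then kdelta K x y else D x y.
have rE : (brank U (n + 1) + #|lev Z n| <=
    \rank (smx E (lev U (n + 1) :|: lev Z n) (lev X n)))%N.
  rewrite lev_split -(rank_kdelta K (lev Z n)) -brank_succ.
  have -> : smx D (lev U (n + 1)) (lev U n) = smx E (lev U (n + 1)) (lev U n).
    apply: eq_smx => x y; rewrite /E !in_lev !in_U.
    by case: (x \in Z).
  have -> : smx (@kdelta K I) (lev Z n) (lev Z n) = smx E (lev Z n) (lev Z n).
    by apply: eq_smx => x y; rewrite /E !in_lev; case: (x \in Z).
  apply: rank_smx_trig => x y; rewrite /E !in_lev in_U => /andP[xZ _].
  case/andP=> /andP[yZ _] _; rewrite xZ /kdelta.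
  by case: eqP yZ => // <-; rewrite xZ.
have := rank_smx_Frobenius E D (lev U (n + 1) :|: lev Z n) (lev X n)
          (lev X (n - 1)).
have -> : smx (fun x z => \sum_(y in lev X n) E x y * D y z)
    (lev U (n + 1) :|: lev Z n) (lev X (n - 1)) = smx D (lev Z n) (lev Z (n - 1)).
  apply: eq_smx => x z; rewrite in_setU !in_lev in_U /E.
  case: (boolP (x \in Z)) => /= xZ.
    have xX := subsetP ZX x xZ; case: (boolP (g x == n)) => //= gx.
    case: (boolP (z \in X)) => zX /=; last first.
      by case: (boolP (z \in Z)) => // /(subsetP ZX); rewrite (negPf zX).
    case: (g z == _) => //=; last by rewrite andbF.
    rewrite (bigD1 x) /= ?in_lev ?xX // big1 => [|y /andP[_ yx]]; last first.
      by rewrite /kdelta eq_sym (negPf yx) mul0r.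
    rewrite /kdelta eqxx mul1r addr0 andbT; case: ifP => // zZ.
    by rewrite DZ // in_U zZ.
  rewrite orbF; case: ifP => // /andP[/andP[xX /eqP gx] /andP[zX _]].
  exact: lev_sum.
by rewrite -/(brank X n) -/(brank Z n) card_lev_split; lia.
Qed.

(** The transposed argument, for the homology of the subcomplex: [E] now has identity columns on
    [lev U n] and differential columns on [lev Z (n - 1)]. *)
Lemma brank_split_le2 n :
  (brank X (n + 1) + brank Z n <= #|lev Z n| + brank U (n + 1))%N.
Proof.
pose E x y := if y \in Z then D x y else kdelta K x y.
have rE : (#|lev U n| + brank Z n <=
    \rank (smx E (lev X n) (lev U n :|: lev Z (n - 1))))%N.
  rewrite lev_split -(rank_kdelta K (lev U n)) /brank.
  have -> : smx D (lev Z n) (lev Z (n - 1)) = smx E (lev Z n) (lev Z (n - 1)).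
    apply: eq_smx => x y; rewrite /E !in_lev.
    by case: (y \in Z); rewrite ?andbF.
  have -> : smx (@kdelta K I) (lev U n) (lev U n) = smx E (lev U n) (lev U n).
    by apply: eq_smx => x y; rewrite /E !in_lev !in_U; case: (y \in Z);
      rewrite ?andbF.
  apply: rank_smx_trig => x y; rewrite /E !in_lev in_U => /andP[xZ _].
  case/andP=> /andP[yZ _] _; rewrite (negPf yZ) /kdelta.
  by case: eqP yZ => // <-; rewrite xZ.
have := rank_smx_Frobenius D E (lev X (n + 1)) (lev X n)
          (lev U n :|: lev Z (n - 1)).
have -> : smx (fun x z => \sum_(y in lev X n) D x y * E y z)
    (lev X (n + 1)) (lev U n :|: lev Z (n - 1)) = smx D (lev U (n + 1)) (lev U n).
  apply: eq_smx => x z; rewrite in_setU !in_lev !in_U /E.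
  case: (boolP (z \in Z)) => /= zZ.
    have zX := subsetP ZX z zZ; rewrite andbF.
    case: ifP => // /andP[/andP[xX /eqP gx] _]; exact: lev_sum.
  rewrite orbF; case: (boolP (z \in X)) => zX /=; last by rewrite !andbF.
  case: (boolP (g z == n)) => gz /=; last by rewrite !andbF.
  case: (boolP (x \in X)) => xX /=; last by rewrite andbF.
  case: (g x == _) => //=; last by rewrite andbF.
  rewrite (bigD1 z) /= ?in_lev ?zX // big1 => [|y /andP[_ yz]]; last first.
    by rewrite /kdelta (negPf yz) mulr0.
  rewrite /kdelta eqxx mulr1 addr0 !andbT; case: ifP => // /negbFE xZ.
  by rewrite DZ // in_U zZ.
by rewrite !brank_succ card_lev_split; lia.
Qed.

Lemma crank_le_open n : (crank n <= betti U n)%N.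
Proof.
have := brank_split_le1 n; have := brank_split_ge n.
have := bettiE n open_complex; rewrite /crank; lia.
Qed.

Lemma crank_le_closed n : (crank (n + 1) <= betti Z n)%N.
Proof.
have := brank_split_le2 n; have := brank_split_ge (n + 1).
have := bettiE n closed_complex; rewrite /crank; lia.
Qed.

(** Of the homology of [U] and [Z] in degree [n], the two neighbouring connecting maps cancel
    [crank n] and [crank (n + 1)]; the rest is the homology of [X]. *)
Lemma betti_les n :
  (betti X n + crank n + crank (n + 1) = betti U n + betti Z n)%N.
Proof.
have := bettiE n open_complex; have := bettiE n closed_complex.
have := bettiE n cX; have := brank_split_ge (n + 1); have := brank_split_ge n.
have := card_lev_split n; rewrite /crank; lia.
Qed.

Lemma betti_closed0 n : betti Z n = 0%N -> betti Z (n - 1) = 0%N ->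
  betti X n = betti U n.
Proof.
have := crank_le_closed n; have := crank_le_closed (n - 1); rewrite subrK.
have := betti_les n; lia.
Qed.

Lemma betti_open0 n : betti U n = 0%N -> betti U (n + 1) = 0%N ->
  betti X n = betti Z n.
Proof.
have := crank_le_open n; have := crank_le_open (n + 1).
have := betti_les n; lia.
Qed.

Lemma betti_le n : (betti X n <= betti U n + betti Z n)%N.
Proof. by have := betti_les n; lia. Qed.

End LongExactSequence.

(** * Acyclicity by filtration, and transport of Betti numbers *)

Lemma betti_set0 n : betti set0 n = 0%N.
Proof.
have l0 : lev set0 n = set0 by apply/setP=> x; rewrite in_lev !in_set0.
by rewrite /betti l0 cards0.
Qed.

(** The differential does not raise [f], so cells of small [f] form a subcomplex. Peeling off the
    top layer reduces acyclicity to the layers, and [betti_le] does so in each degree separately. *)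
Lemma betti_filtration (f : I -> nat) X n : is_complex X ->
  (forall x y, x \in X -> y \in X -> D x y != 0 -> (f y <= f x)%N) ->
  (forall m, betti [set x in X | f x == m] n = 0%N) -> betti X n = 0%N.
Proof.
move=> cX fD f0.
have [N] : exists N, forall x, x \in X -> (f x < N)%N.
  by exists (\max_x f x).+1 => x _; rewrite ltnS; apply: leq_bigmax.
elim: N X cX fD f0 => [|N IHN] X cX fD f0 fN.
  suff -> : X = set0 by apply: betti_set0.
  by apply/setP=> x; rewrite in_set0; apply/negP => /fN.
pose Z := [set x in X | f x < N]%N.
have ZX : Z \subset X by apply/subsetP=> x; rewrite inE => /andP[].
have DZ x y : x \in Z -> y \in X :\: Z -> D x y = 0.
  rewrite !inE => /andP[xX fx] /andP[fy yX]; move: fy; rewrite yX /= => fy.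
  apply/eqP; apply: contraNT fy => /(fD x y xX yX); lia.
have UE : X :\: Z = [set x in X | f x == N].
  apply/setP=> x; rewrite !inE; case: (boolP (x \in X)) => xX /=.
    by have := fN x xX; lia.
  by [].
apply/eqP; rewrite -leqn0; apply: leq_trans (betti_le cX ZX DZ n) _.
rewrite UE f0 leqn0; apply/eqP; apply: IHN.
- exact: closed_complex cX ZX DZ.
- by move=> x y /(subsetP ZX) xX /(subsetP ZX) yX; apply: fD.
- move=> m; have [mN|mN] := ltnP m N.
    rewrite -(f0 m); congr betti; apply/setP=> x; rewrite !inE.
    by case: (x \in X) => //=; lia.
  suff -> : [set x in Z | f x == m] = set0 by apply: betti_set0.
  by apply/setP=> x; rewrite !inE; case: (x \in X) => //=; lia.
- by move=> x; rewrite inE => /andP[].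
Qed.

(** The layers are now the fibres of [key], ordered only partially by [f]; ties are broken by an
    arbitrary ranking of the keys. *)
Lemma betti_fibers (T : finType) (key : I -> T) (f : T -> nat) X n :
  is_complex X ->
  (forall x y, x \in X -> y \in X -> D x y != 0 ->
     key y = key x \/ (f (key y) < f (key x))%N) ->
  (forall t, betti [set x in X | key x == t] n = 0%N) -> betti X n = 0%N.
Proof.
move=> cX fD f0; pose N := #|T|.+1.
have rN (t : T) : (enum_rank t < N)%N by apply: leqW.
(* The rank stays below [N], so [F] is dominated by [f] and still determines the key, as the
   remainder modulo [N]. *)
pose F x := (f (key x) * N + enum_rank (key x))%N.
apply: (betti_filtration (f := F)) => // [x y xX yX /(fD x y xX yX)|m].
  rewrite /F => -[->//|lt_f]; have := rN (key y).
  have : ((f (key y)).+1 * N <= f (key x) * N)%N by rewrite leq_mul2r lt_f orbT.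
  by rewrite mulSn; lia.
have [[x /andP[xX /eqP Fx]]|noX] :=
  altP (@existsP _ (fun x => (x \in X) && (F x == m))).
  rewrite -(f0 (key x)); congr betti; apply/setP=> y; rewrite !inE.
  case: (y \in X) => //=; rewrite -Fx; rewrite /F.
  apply/eqP/eqP => [e|->//]; apply: enum_rank_inj; apply: val_inj => /=.
  have := congr1 (modn^~ N) e.
  by rewrite !modnMDl !modn_small.
suff -> : [set x in X | F x == m] = set0 by apply: betti_set0.
by apply/setP=> x; rewrite !inE; apply: contraNF noX => Fx; apply/existsP; exists x.
Qed.

Lemma lev_pair x y n : g x = g y + 1 ->
  lev [set x; y] n = if n == g x then [set x] else
                     if n == g y then [set y] else set0.
Proof.
move=> gxy; apply/setP=> z; rewrite in_lev in_set2.
case: (eqVneq n (g x)) => [->|nx].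
  rewrite in_set1; case: (eqVneq z x) => [->|_] /=; first by rewrite eqxx.
  by case: (eqVneq z y) => //= ->; apply/negP; lia.
case: (eqVneq n (g y)) => [->|ny].
  rewrite in_set1; case: (eqVneq z y) => [->|_] /=; first by rewrite orbT eqxx.
  by case: (eqVneq z x) => //= ->; apply/negP; lia.
rewrite in_set0; apply/negP => /andP[/orP[] /eqP -> /eqP gz].
  by rewrite gz eqxx in nx.
by rewrite gz eqxx in ny.
Qed.

Lemma betti_pair x y n : g x = g y + 1 -> D x y != 0 ->
  betti [set x; y] n = 0%N.
Proof.
move=> gxy Dxy; rewrite /betti.
have [xX yX] : x \in lev [set x; y] (g x) /\ y \in lev [set x; y] (g y).
  by rewrite !in_lev !in_set2 !eqxx orbT.
have gyx : g x - 1 = g y by rewrite gxy addrK.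
have: (0 < brank [set x; y] (g x))%N.
  by rewrite /brank gyx; apply: rank_smx_gt0 xX yX Dxy.
have c n' : (#|lev [set x; y] n'| <= ((n' == g x) || (n' == g y)))%N.
  by rewrite lev_pair //; do 2 case: eqP => _; rewrite ?cards1 ?cards0.
have := c n; case: (eqVneq n (g x)) => [->|_] /=; first by lia.
case: (eqVneq n (g y)) => [->|_] /=; last by lia.
by rewrite -gxy; lia.
Qed.

End Betti.

Lemma betti_reindex (K : fieldType) (I J : finType) (D : I -> I -> K)
    (E : J -> J -> K) (g : I -> int) (h : J -> int) (p : I -> J) (c : int)
    (e e' : I -> K) (X : {set I}) n :
  {in X &, injective p} -> {in X, forall x, h (p x) = g x + c} ->
  (forall x, x \in X -> e x != 0) -> (forall x, x \in X -> e' x != 0) ->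
  {in X &, forall x y, E (p x) (p y) = e x * e' y * D x y} ->
  betti E h (p @: X) (n + c) = betti D g X n.
Proof.
move=> pI hp e0 e0' ED.
have levE m : lev h (p @: X) (m + c) = p @: lev g X m.
  apply/setP=> y; rewrite in_lev; apply/andP/imsetP => [[/imsetP[x xX ->]]|].
    by rewrite hp // => /eqP/addIr gx; exists x; rewrite // in_lev xX gx eqxx.
  case=> x; rewrite in_lev => /andP[xX /eqP gx] ->; split.
    by apply/imsetP; exists x.
  by rewrite hp // gx.
have sub m : {subset lev g X m <= X} by move=> x; rewrite in_lev => /andP[].
have rkE m : brank E h (p @: X) (m + c) = brank D g X m.
  rewrite /brank addrAC !levE; apply: (rank_smx_reindex (e := e) (e' := e')).
  - by move=> x y /sub xX /sub yX; apply: pI.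
  - by move=> x y /sub xX /sub yX; apply: pI.
  - by move=> x /sub; apply: e0.
  - by move=> x /sub; apply: e0'.
  - by move=> x y /sub xX /sub yX; apply: ED.
rewrite /betti [n + c + 1]addrAC !rkE levE card_in_imset //.
by move=> x y /sub xX /sub yX; apply: pI.
Qed.

(** Transposing [D] and negating degrees exchanges the two ranks in the Betti number. This brings
    transposed factors of the duality complex back to ordinary chains. *)
Lemma betti_dual (K : fieldType) (I : finType) (D : I -> I -> K) (g : I -> int)
    (X : {set I}) n :
  betti (fun x y => D y x) (fun x => - g x) X (- n) = betti D g X n.
Proof.
have levE m : lev (fun x => - g x) X (- m) = lev g X m.
  by apply/setP=> x; rewrite !in_lev eqr_opp.
have rkE m : brank (fun x y => D y x) (fun x => - g x) X (- m) =
             brank D g X (m + 1).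
  rewrite /brank -opprD !levE addrK; exact: rank_smx_tr.
rewrite /betti levE rkE -[- n + 1]opprK opprD opprK rkE subrK.
by rewrite -!subnDA addnC.
Qed.

(** * Incidence numbers, stars and links *)

Section Incidence.

Variables (K : fieldType) (V : finType).
Implicit Types (s t u rho : {set V}) (v w : V) (X : {set {set V}}).

Local Notation inc := (incidence K).

Definition rank_below t v : nat := #|[set u in t | (enum_rank u < enum_rank v)%N]|.

Lemma fdim_setU1 v t : v \notin t -> fdim (v |: t) = fdim t + 1.
Proof. by move=> vt; rewrite /fdim cardsU1 vt; lia. Qed.

Lemma incidence_setU1 v t : v \notin t ->
  inc (v |: t) t = (-1) ^+ rank_below t v.
Proof.
move=> vt; rewrite /incidence (big_pred1 v) // => w.
apply/andP/eqP => [[wt /eqP eq_vw]|->]; last by rewrite eqxx.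
by have := setU11 w t; rewrite -eq_vw in_setU1 (negPf wt) orbF => /eqP.
Qed.

Lemma incidence_setU1_neq0 v t : v \notin t -> inc (v |: t) t != 0.
Proof. by move=> vt; rewrite incidence_setU1 // signr_eq0. Qed.

Lemma incidence_neq0 s t : inc s t != 0 -> exists2 v, v \notin t & s = v |: t.
Proof.
move=> st; suff /existsP[v /andP[vt /eqP svt]] :
    [exists v, (v \notin t) && (s == v |: t)] by exists v.
apply: contraNT st; rewrite negb_exists => /forallP st.
by rewrite /incidence big_pred0 // => v; apply/negbTE.
Qed.

Lemma incidence_subset s t : inc s t != 0 -> t \subset s.
Proof. by case/incidence_neq0 => v _ ->; apply: subsetUr. Qed.

Lemma incidence_fdim s t : inc s t != 0 -> fdim s = fdim t + 1.
Proof. by case/incidence_neq0 => v vt ->; apply: fdim_setU1. Qed.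

Lemma incidence_subset_neq0 s t : t \subset s -> fdim s = fdim t + 1 ->
  inc s t != 0.
Proof.
move=> ts ds; have: #|s :\: t| = 1%N.
  by rewrite cardsD (setIidPr ts); move: ds; rewrite /fdim; lia.
move/eqP/cards1P => [v sv]; have vst: v \in s :\: t by rewrite sv set11.
have -> : s = v |: t by rewrite -sv setUC setDE setUIr setUCr setIT; apply/esym/setUidPr.
by apply: incidence_setU1_neq0; move: vst; rewrite inE => /andP[].
Qed.

Lemma rank_below_setU1 v w t : w \notin t ->
  rank_below (w |: t) v = (rank_below t v + (enum_rank w < enum_rank v))%N.
Proof.
move=> wt; rewrite /rank_below; case: (boolP (_ < _)%N) => wv.
  have -> : [set u in w |: t | (enum_rank u < enum_rank v)%N] =
      w |: [set u in t | (enum_rank u < enum_rank v)%N].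
    apply/setP=> u; rewrite !inE andb_orl; congr orb.
    by case: eqP => // ->.
  by rewrite cardsU1 inE (negPf wt) addnC.
rewrite addn0; congr (#|pred_of_set _|); apply/setP=> u; rewrite !inE andb_orl.
by case: eqP => //= ->; rewrite (negPf wv) andbF.
Qed.

(** Only [v |: u] and [w |: u] lie in between. Each added vertex is counted below the other one only
    if it is smaller, so exactly one exponent changes by one and the two terms cancel. *)
Lemma incidence_square s u : \sum_t inc s t * inc t u = 0.
Proof.
have [[t]|no] := altP (@existsP _ (fun t => inc s t * inc t u != 0)); last first.
  rewrite big1 // => t _; apply/eqP; move: no; rewrite negb_exists.
  by move/forallP/(_ t)/negPn.
rewrite mulf_eq0 negb_or => /andP[/incidence_neq0[v vt ->]].
case/incidence_neq0 => w wu tE; move: vt; rewrite tE {t tE} in_setU1 negb_or.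
case/andP=> vw vu; have wv : w \notin v |: u by rewrite in_setU1 negb_or eq_sym vw.
rewrite (bigD1 (w |: u)) //= (bigD1 (v |: u)) /=; last first.
  apply: contra_neq vw => /setP/(_ v); rewrite setU11 in_setU1 (negPf vu) orbF.
  by move/esym/eqP.
rewrite big1 => [|t /andP[tw tv]]; last first.
  apply/eqP; rewrite mulf_eq0; apply: contraNT tw; rewrite negb_or => /andP[].
  case/incidence_neq0 => v' v't svt /incidence_neq0[w' w'u tE].
  move: tv; have : w' \in v |: (w |: u) by rewrite svt tE !in_setU1 eqxx orbT.
  rewrite !in_setU1 (negPf w'u) orbF tE => /orP[] /eqP ->; rewrite ?eqxx //.
rewrite addr0 [in X in _ + X]setUCA !incidence_setU1 //; last first.
  by rewrite in_setU1 negb_or vw.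
rewrite !rank_below_setU1 // -!exprD.
case: (ltngtP (enum_rank w) (enum_rank v)) => [_|_|e].
- by rewrite addn1 addn0 addSn exprS mulN1r [(rank_below u w + _)%N]addnC addNr.
- rewrite addn1 addn0 addSn [X in _ + X]exprS mulN1r.
  by rewrite [(rank_below u w + _)%N]addnC addrN.
- by move/val_inj/enum_rank_inj: e vw => ->; rewrite eqxx.
Qed.

(** Besides simplicial complexes this covers stars, which are not closed under taking subsets. *)
Definition convex X : Prop := forall s t u,
  s \in X -> u \in X -> u \subset t -> t \subset s -> t \in X.

Lemma incidence_complex X : convex X -> is_complex inc (@fdim V) X.
Proof.
move=> cX; split=> [s t _ _|s u sX uX]; first exact: incidence_fdim.
rewrite -[RHS](incidence_square s u) [RHS](bigID (mem X)) /=.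
rewrite [X in _ = _ + X]big1 ?addr0 // => t tX.
apply/eqP; rewrite mulf_eq0; apply: contraNT tX; rewrite negb_or.
by case/andP=> /incidence_subset ts /incidence_subset ut; apply: cX ut ts.
Qed.

(** The open star. In a simplicial complex its chains are those of the link shifted by [#|rho|], see
    [betti_link]; unlike links, stars need no relabelling of faces when [rho] varies. *)
Definition star X rho : {set {set V}} := [set t in X | rho \subset t].

Lemma in_star X rho t : (t \in star X rho) = (t \in X) && (rho \subset t).
Proof. by rewrite inE. Qed.

Lemma convex_star X rho : convex X -> convex (star X rho).
Proof.
move=> cX s t u; rewrite !in_star => /andP[sX _] /andP[uX ru] ut ts.
by rewrite (cX _ _ _ sX uX ut ts) (subset_trans ru ut).
Qed.

Lemma convex_complex (C : simplicial_complex V) : convex (faces C).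
Proof. by move=> s t u sC _ _; apply: faces_closed. Qed.

(** Toggling a vertex [v] of [s] outside [rho] matches the faces of the interval in pairs; these are
    the fibres of [t :\ v], and each is acyclic. *)
Lemma betti_interval rho s n : rho \proper s ->
  betti inc (@fdim V) (star [set t : {set V} | t \subset s] rho) n = 0%N.
Proof.
case/properP=> rs [v vs vr].
have cX : convex (star [set t : {set V} | t \subset s] rho).
  apply: convex_star => s' t u; rewrite !inE => s's _ _ ts'.
  exact: subset_trans ts' s's.
apply: (betti_fibers (key := fun t => t :\ v) (f := fun t => #|t|)).
- exact: incidence_complex.
- move=> x y _ _ /incidence_neq0[w wy ->].
  case: (eqVneq w v) => [->|wv]; [left | right].
    by apply/setP=> z; rewrite !inE; case: eqP.
  have -> : (w |: y) :\ v = w |: (y :\ v).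
    by apply/setP=> z; rewrite !inE; case: (eqVneq z w) => [->|]; rewrite ?wv.
  by rewrite cardsU1 inE (negPf wy) andbF.
move=> t0; case: (boolP [&& rho \subset t0, t0 \subset s & v \notin t0]) => t0P.
  case/and3P: t0P => rt0 t0s vt0.
  have -> : [set x in star [set t : {set V} | t \subset s] rho | x :\ v == t0] =
            [set v |: t0; t0].
    apply/setP=> x; rewrite !inE; apply/idP/idP.
      case/andP=> _ /eqP <-; case: (boolP (v \in x)) => vx.
        by rewrite setD1K // eqxx.
      by rewrite (setDidPl _) ?eqxx ?orbT // disjoint_sym disjoints1.
    case/orP=> /eqP ->.
      rewrite subUset sub1set vs t0s subsetU ?rt0 ?orbT //=.
      by rewrite setU1K.
    by rewrite t0s rt0 /=; apply/eqP/setDidPl; rewrite disjoint_sym disjoints1.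
  apply: betti_pair; first exact: fdim_setU1.
  exact: incidence_setU1_neq0.
suff -> : [set x in star [set t : {set V} | t \subset s] rho | x :\ v == t0] = set0.
  exact: betti_set0.
apply/setP=> x; rewrite !inE; apply: contraNF t0P.
case/andP=> /andP[xs rx] /eqP <-; rewrite setD11 andbT.
rewrite (subset_trans (subsetDl _ _) xs) andbT.
by rewrite subsetD rx disjoint_sym disjoints1.
Qed.

(* Joining a face disjoint from t reorders the vertices by a sign. *)
Definition join_sign s t : K := \prod_(v in t) (-1) ^+ rank_below s v.

Lemma join_sign_neq0 s t : join_sign s t != 0.
Proof. by apply/prodf_neq0 => v _; rewrite signr_eq0. Qed.

Lemma rank_below_setU s t v : [disjoint s & t] ->
  rank_below (t :|: s) v = (rank_below t v + rank_below s v)%N.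
Proof.
move=> st; rewrite /rank_below -cardsUI [X in (_ = _ + X)%N]eq_card0 ?addn0.
  by congr (#|pred_of_set _|); apply/setP=> u; rewrite !inE andb_orl.
move=> u; rewrite !inE; apply/negP => /andP[/andP[ut _] /andP[us _]].
by rewrite (disjointFr st us) in ut.
Qed.

(** If [t] arises from [t'] by adding [v], joining [s] contributes the sign
    [(-1) ^+ rank_below s v], which is the ratio of the two join signs. *)
Lemma incidence_join s t t' : [disjoint s & t] -> [disjoint s & t'] ->
  inc (t :|: s) (t' :|: s) = join_sign s t * join_sign s t' * inc t t'.
Proof.
move=> st st'; have [tt'0|] := eqVneq (inc t t') 0.
  rewrite tt'0 mulr0; apply: contra_eq tt'0 => tt'.
  apply: incidence_subset_neq0.
    have := setSD s (incidence_subset tt'); rewrite !setDUl setDv !setU0.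
    by move: st st'; rewrite ![[disjoint s & _]]disjoint_sym => /setDidPl -> /setDidPl ->.
  have := incidence_fdim tt'; rewrite /fdim !cardsU.
  move: st st'; rewrite ![[disjoint s & _]]disjoint_sym -!setI_eq0 => /eqP -> /eqP ->.
  by rewrite cards0; lia.
case/incidence_neq0=> v vt' tE; move: st; rewrite tE => st.
have vs : v \notin s by rewrite (disjointFl st) // setU11.
rewrite -setUA !incidence_setU1 ?in_setU ?negb_or ?vt' //.
rewrite rank_below_setU // exprD [join_sign s (v |: t')]/join_sign big_setU1 //=.
rewrite -/(join_sign s t').
rewrite -!mulrA [join_sign s t' * (_ * _)]mulrA.
suff -> : join_sign s t' * join_sign s t' = 1 by rewrite mul1r mulrC.
by rewrite -big_split big1 // => u _ /=; rewrite -expr2 sqrr_sign.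
Qed.

Lemma link_star (C : simplicial_complex V) s :
  [set t :|: s | t in faces (link C s)] = star (faces C) s.
Proof.
apply/setP=> u; rewrite in_star; apply/imsetP/andP => [[t]|[uC su]].
  by rewrite inE => /and3P[_ tsC _] ->; rewrite subsetUr.
exists (u :\: s); last by rewrite setUC setDE setUIr setUCr setIT; apply/esym/setUidPr.
rewrite inE (faces_closed uC (subsetDl _ _)) /= setUC setDE setUIr setUCr setIT.
by rewrite (setUidPr su) uC -setDE setIC setIDA setIC -setIDA setDv setI0 eqxx.
Qed.

Lemma link_disjoint (C : simplicial_complex V) s t :
  t \in faces (link C s) -> [disjoint s & t].
Proof. by rewrite inE disjoint_sym -setI_eq0 => /and3P[_ _]. Qed.

Lemma betti_link (C : simplicial_complex V) s n :
  betti inc (@fdim V) (faces (link C s)) n =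
  betti inc (@fdim V) (star (faces C) s) (n + #|s|%:Z).
Proof.
rewrite -link_star; apply/esym.
apply: (betti_reindex (e := join_sign s) (e' := join_sign s)).
- move=> t u /link_disjoint ts /link_disjoint us /(congr1 (fun x => x :\: s)).
  rewrite !setDUl setDv !setU0.
  by move: ts us; rewrite ![[disjoint s & _]]disjoint_sym => /setDidPl -> /setDidPl ->.
- move=> t /link_disjoint; rewrite disjoint_sym -setI_eq0 /fdim cardsU => /eqP ->.
  by rewrite cards0; lia.
- by move=> *; apply: join_sign_neq0.
- by move=> *; apply: join_sign_neq0.
- by move=> t u /link_disjoint ts /link_disjoint us; apply: incidence_join.
Qed.

Lemma star0 X : star X set0 = X.
Proof. by apply/setP=> t; rewrite in_star sub0set andbT. Qed.

End Incidence.

(** * Homology in coordinates *)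

Section QuotientCoordinates.

Local Open Scope quotient_scope.

Variables (K : fieldType) (vT : vectType K) (U : {vspace vT}).

Let W := (U^C)%VS.

(** The quotient is only an lmodule, so its coordinates are borrowed from a fixed complement of [U],
    to which projection along [U] identifies it. *)
Definition vquot_coord (x : vquot U) : 'rV[K]_(\dim W) :=
  \row_i coord (vbasis W) i (daddv_pi W U (repr x)).

Definition vquot_vec (r : 'rV[K]_(\dim W)) : vquot U :=
  \pi_(vquot U) (\sum_i r 0 i *: (vbasis W)`_i).

Let WU0 : (W :&: U = 0)%VS.
Proof. by rewrite capvC capv_compl. Qed.

Lemma daddv_pi_compl_eq0 x : (daddv_pi W U x == 0) = (x \in U).
Proof.
have xWU : x \in (W + U)%VS by rewrite addvC addv_complf memvf.
have UW0 : (U :&: W = 0)%VS by apply: capv_compl.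
apply/eqP/idP => [x0|xU].
  by rewrite -(daddv_pi_add WU0 xWU) x0 add0r memv_pi.
have := daddv_pi_add WU0 xWU; rewrite (daddv_pi_id UW0 xU).
by move/(canRL (addrK x)); rewrite subrr.
Qed.

Lemma vquot_coord_pi x :
  vquot_coord (\pi x) = \row_i coord (vbasis W) i (daddv_pi W U x).
Proof.
apply/rowP=> i; rewrite !mxE; apply/eqP; rewrite -subr_eq0 -linearB -linearB /=.
by have := vquot_reprP U x; rewrite -daddv_pi_compl_eq0 => /eqP ->; rewrite linear0.
Qed.

Lemma vquot_coord_linear : linear vquot_coord.
Proof.
move=> a; elim/vquotW=> x; elim/vquotW=> y.
rewrite -linearP !vquot_coord_pi; apply/rowP=> i.
by rewrite !mxE !linearP.
Qed.

HB.instance Definition _ := GRing.isLinear.Build K (vquot U) _ _ vquot_coord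
  vquot_coord_linear.

Lemma vquot_vec_linear : linear vquot_vec.
Proof.
move=> a r s; rewrite /vquot_vec -linearP scaler_sumr -big_split /=.
by congr \pi; apply: eq_bigr => i _; rewrite !mxE scalerDl scalerA.
Qed.

HB.instance Definition _ := GRing.isLinear.Build K _ (vquot U) _ vquot_vec
  vquot_vec_linear.

Lemma vquot_coordK : cancel vquot_coord vquot_vec.
Proof.
elim/vquotW=> x; rewrite vquot_coord_pi; apply/eqP; rewrite vquot_piE.
under eq_bigr do rewrite mxE.
rewrite -coord_vbasis ?memv_pi //.
have xWU : x \in (W + U)%VS by rewrite addvC addv_complf memvf.
rewrite -{2}(daddv_pi_add WU0 xWU) opprD addNKr.
by rewrite memvN memv_pi.
Qed.

Lemma vquot_vecK : cancel vquot_vec vquot_coord.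
Proof.
move=> r; rewrite vquot_coord_pi; apply/rowP=> i; rewrite mxE.
rewrite daddv_pi_id ?coord_sum_free ?(basis_free (vbasisP _)) //.
by apply: memv_suml => j _; rewrite memvZ // vbasis_mem // mem_nth ?size_tuple.
Qed.

End QuotientCoordinates.

Section HomologyDimension.

Variables (K : fieldType) (U V W : vectType K).
Variables (f : 'Hom(U, V)) (g : 'Hom(V, W)).

Definition homology_dim : nat :=
  \dim ((linfun (vsval : subvs_of (lker g) -> V)) @^-1: limg f)^C%VS.

(** The condition places [limg f] inside the image of the injective inclusion of [lker g], so the
    preimage taken in [homology_at] keeps the dimension of [limg f]. *)
Lemma homology_dimE : (limg f <= lker g)%VS ->
  homology_dim = (\dim {:V} - \dim (limg g) - \dim (limg f))%N.
Proof.
move=> fg; rewrite /homology_dim dimv_compl dimvf.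
set j := linfun _; have jker : lker j = 0%VS.
  apply/eqP; rewrite -subv0; apply/subvP=> x; rewrite memv_ker lfunE /= memv0.
  by move=> /eqP x0; apply/eqP/val_inj; rewrite /= x0.
have imj : limg j = lker g.
  apply/vspaceP=> x; apply/memv_imgP/idP => [[y _ ->]|xg].
    by rewrite lfunE subvsP.
  by exists (vsproj (lker g) x); rewrite ?memvf // lfunE /= vsprojK.
have -> : dim (subvs_of (lker g)) = \dim (lker g) by [].
have <- := limg_ker_dim g fullv; rewrite capfv addnK.
have /(_ (j @^-1: limg f)%VS) := @limg_dim_eq _ _ _ j; rewrite jker capv0 => <- //.
by rewrite lpreimK // imj.
Qed.

End HomologyDimension.

Lemma limg_sub_lker (K : fieldType) (U V W : vectType K) (f : 'Hom(U, V))
  (g : 'Hom(V, W)) : (forall x, g (f x) = 0) -> (limg f <= lker g)%VS.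
Proof.
move=> gf; apply/subvP=> y /memv_imgP[x _ ->].
by rewrite memv_ker gf.
Qed.

Section MatrixOfFaceMap.

Variables (K : fieldType) (I : finType).

Section Coordinates.

Variable P : pred I.

(** Zeros are put at the elements outside [P], matching the padding of [smx]. *)
Definition face_row (c : {ffun {x | P x} -> K^o}) : 'rV[K]_#|I| :=
  \row_j oapp c 0 (insub (enum_val j)).

Definition row_face (r : 'rV[K]_#|I|) : {ffun {x | P x} -> K^o} :=
  [ffun x => r 0 (enum_rank (val x))].

Lemma face_row_linear : linear face_row.
Proof.
move=> a c e; apply/rowP=> j; rewrite !mxE.
by case: insubP => [u _ _|_] /=; rewrite ?ffunE // mulr0 addr0.
Qed.

HB.instance Definition _ := GRing.isLinear.Build K _ _ _ face_row face_row_linear.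

Lemma row_face_linear : linear row_face.
Proof. by move=> a c e; apply/ffunP=> x; rewrite !ffunE !mxE. Qed.

HB.instance Definition _ := GRing.isLinear.Build K _ _ _ row_face row_face_linear.

Lemma big_face (T : nmodType) (F : I -> T) :
  \sum_(s : {x | P x}) F (val s) = \sum_(s in [set x | P x]) F s.
Proof.
rewrite [RHS](eq_bigl P) => [|x]; last by rewrite inE.
by rewrite (big_sub P).
Qed.

End Coordinates.

Variables (P Q : pred I) (E : I -> I -> K).
Variable F : {linear {ffun {x | P x} -> K^o} -> {ffun {x | Q x} -> K^o}}.
Hypothesis FE : forall c t, F c t = \sum_s E (val s) (val t) * c s.

Let M := smx E [set x | P x] [set x | Q x].

Lemma face_mapE c : F c = row_face Q (face_row c *m M).
Proof.
apply/ffunP=> t; rewrite FE ffunE mxE.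
rewrite (reindex _ (onW_bij _ (enum_rank_bij I))) /=.
under [RHS]eq_bigr do rewrite !mxE !enum_rankK !inE (valP t) andbT.
rewrite (bigID P) /= [X in _ = _ + X]big1 ?addr0 => [|x Px]; last first.
  by rewrite insubN //= mul0r.
rewrite (eq_bigl (fun x => x \in [set x | P x])) => [|x]; last by rewrite inE.
rewrite -(big_face P (fun x => oapp c 0 (insub x) * (if P x then E x (val t) else 0))).
by apply: eq_bigr => s _; rewrite valK /= (valP s) mulrC.
Qed.

Lemma face_map_matrix r : r *m M = face_row (F (row_face P r)).
Proof.
apply/rowP=> j; rewrite !mxE; case: insubP => [t _ tj|Qj] /=; last first.
  by rewrite big1 // => i _; rewrite mxE [X in _ && X]inE (negPf Qj) andbF mulr0.
rewrite FE (reindex _ (onW_bij _ (enum_rank_bij I))) /=.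
under eq_bigr do rewrite !mxE enum_rankK -tj !inE (valP t) andbT.
rewrite (bigID P) /= [X in _ + X]big1 ?addr0 => [|x Px]; last first.
  by rewrite (negPf Px) mulr0.
rewrite (eq_bigl (fun x => x \in [set x | P x])) => [|x]; last by rewrite inE.
rewrite -(big_face P (fun x => r 0 (enum_rank x) * (if P x then E x (val t) else 0))).
by apply: eq_bigr => s _; rewrite ffunE (valP s) mulrC.
Qed.

Import VectorInternalTheory.

(** The basis behind [f2mx] stays abstract: each of the two matrices is factored through the other
    by means of [face_row] and [row_face]. *)
Lemma dim_limg_face_map : \dim (limg (linfun F)) = \rank M.
Proof.
have dimE : \dim (limg (linfun F)) = \rank (f2mx (linfun F)).
  have full : row_full (vs2mx {:{ffun {x | P x} -> K^o}}%VS).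
    by rewrite /row_full -[X in X == _]/(\dim _) dimvf.
  move: (linfun F) => h; rewrite unlock /lfun_img_def /dimv mx2vsK.
  by rewrite (eqmxMfull _ full).
rewrite dimE; pose fm := f2mx (linfun F).
have fmE u : u *m fm = v2r (F (r2v u)).
  by rewrite -(lfunE F) unlock /= r2vK r2vK.
apply/eqP; rewrite eqn_leq; apply/andP; split.
  pose Ra := lin1_mx (@face_row P \o r2v).
  pose Rb := lin1_mx (v2r \o row_face Q).
  have -> : f2mx (linfun F) = Ra *m M *m Rb.
    apply/row_matrixP=> i; rewrite !rowE -/fm fmE !mulmxA.
    by rewrite !mul_rV_lin1 /= face_mapE.
  exact: leq_trans (mxrankM_maxl _ _) (mxrankM_maxr _ _).
pose Ra := lin1_mx (v2r \o row_face P).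
pose Rb := lin1_mx (@face_row Q \o r2v).
have -> : M = Ra *m fm *m Rb.
  apply/row_matrixP=> i; rewrite !rowE face_map_matrix !mulmxA.
  by rewrite mul_rV_lin1 fmE mul_rV_lin1 /= !v2rK.
exact: leq_trans (mxrankM_maxl _ _) (mxrankM_maxr _ _).
Qed.

End MatrixOfFaceMap.

Section ReducedBetti.

Variables (K : fieldType) (V : finType) (C : simplicial_complex V).

Local Notation inc := (incidence K).
Local Notation dim_ := (@fdim V).

Definition rbetti (D : simplicial_complex V) (i : int) : nat :=
  betti inc dim_ (faces D) i.

Lemma dim_limg_bd i j :
  \dim (limg (bd K C i j)) = \rank (smx inc (lev dim_ C i) (lev dim_ C j)).
Proof.
rewrite -(@dim_limg_face_map K _ (fun s => (s \in faces C) && (fdim s == i))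
  (fun s => (s \in faces C) && (fdim s == j)) inc (@bd_fun V K C i j)) //.
by move=> c t; rewrite ffunE.
Qed.

Lemma dim_limg_cobd i j :
  \dim (limg (cobd K C i j)) = \rank (smx inc (lev dim_ C j) (lev dim_ C i)).
Proof.
rewrite -rank_smx_tr.
rewrite -(@dim_limg_face_map K _ (fun s => (s \in faces C) && (fdim s == i))
  (fun s => (s \in faces C) && (fdim s == j)) (fun s t => inc t s)
  (@cobd_fun V K C i j)) //.
by move=> c t; rewrite ffunE.
Qed.

Lemma dim_chain i : \dim {:chain K C i} = #|lev dim_ C i|.
Proof.
rewrite dimvf; have -> : dim (chain K C i) = (#|{: face_of_dim C i}| * 1)%N by [].
rewrite muln1 card_sig; apply: eq_card => s.
by rewrite inE in_lev.
Qed.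

Lemma sum_face_of_dim i (F : {set V} -> K) :
  \sum_(s : face_of_dim C i) F (val s) = \sum_(s in lev dim_ C i) F s.
Proof. exact: (@big_face _ (fun s => (s \in faces C) && (fdim s == i))). Qed.

Let cC : is_complex inc dim_ (faces C).
Proof. exact: incidence_complex (@convex_complex _ C). Qed.

Lemma bd_bd i x : bd K C i (i - 1) (bd K C (i + 1) i x) = 0.
Proof.
apply/ffunP=> t; rewrite !lfunE /= !ffunE.
under eq_bigr do rewrite ffunE mulr_sumr.
rewrite exchange_big big1 //= => s _.
under eq_bigr do rewrite mulrA [_ * incidence _ _ _]mulrC.
rewrite -mulr_suml (sum_face_of_dim i (fun u => inc (val s) u * inc u (val t))).
have [/andP[sC /eqP ds] /andP[tC _]] := (valP s, valP t).
by rewrite (lev_sum cC) ?mul0r.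
Qed.

Lemma cobd_cobd i x : cobd K C i (i + 1) (cobd K C (i - 1) i x) = 0.
Proof.
apply/ffunP=> t; rewrite !lfunE /= !ffunE.
under eq_bigr do rewrite ffunE mulr_sumr.
rewrite exchange_big big1 //= => s _.
under eq_bigr do rewrite mulrA.
rewrite -mulr_suml (sum_face_of_dim i (fun u => inc (val t) u * inc u (val s))).
have [/andP[sC _] /andP[tC /eqP dt]] := (valP s, valP t).
by rewrite (lev_sum cC) ?mul0r.
Qed.

Definition redH_dim i : nat := homology_dim (bd K C (i + 1) i) (bd K C i (i - 1)).
Definition redcoH_dim i : nat :=
  homology_dim (cobd K C (i - 1) i) (cobd K C i (i + 1)).

Lemma redH_dimE i : redH_dim i = rbetti C i.
Proof.
rewrite /redH_dim homology_dimE; last by apply: limg_sub_lker; apply: bd_bd.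
by rewrite !dim_limg_bd dim_chain /rbetti /betti -brank_succ.
Qed.

(** The same two ranks are subtracted as for homology, in the opposite order. *)
Lemma redcoH_dimE i : redcoH_dim i = rbetti C i.
Proof.
rewrite /redcoH_dim homology_dimE; last by apply: limg_sub_lker; apply: cobd_cobd.
rewrite !dim_limg_cobd dim_chain /rbetti /betti -brank_succ.
by rewrite -!subnDA addnC.
Qed.

Definition redH_coord i : {linear redH K C i -> 'rV[K]_(redH_dim i)} :=
  @vquot_coord _ _ _.
Definition redH_vec i : {linear 'rV[K]_(redH_dim i) -> redH K C i} :=
  @vquot_vec _ _ _.
Definition redcoH_coord i : {linear redcoH K C i -> 'rV[K]_(redcoH_dim i)} :=
  @vquot_coord _ _ _.
Definition redcoH_vec i : {linear 'rV[K]_(redcoH_dim i) -> redcoH K C i} :=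
  @vquot_vec _ _ _.

Lemma redH_coordK i : cancel (redH_coord i) (redH_vec i).
Proof. exact: vquot_coordK. Qed.
Lemma redH_vecK i : cancel (redH_vec i) (redH_coord i).
Proof. exact: vquot_vecK. Qed.
Lemma redcoH_coordK i : cancel (redcoH_coord i) (redcoH_vec i).
Proof. exact: vquot_coordK. Qed.
Lemma redcoH_vecK i : cancel (redcoH_vec i) (redcoH_coord i).
Proof. exact: vquot_vecK. Qed.

Lemma redH_eq0P i : (forall x : redH K C i, x = 0) <-> rbetti C i = 0%N.
Proof.
rewrite -redH_dimE; split=> [H0|d0 x].
  apply/eqP; rewrite -leqn0 leqNgt; apply/negP => d_gt0.
  have := H0 (redH_vec i (const_mx 1)) => /(congr1 (redH_coord i)).
  rewrite redH_vecK linear0 => /rowP/(_ (Ordinal d_gt0)) /eqP.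
  by rewrite !mxE oner_eq0.
apply: (can_inj (@redH_coordK i)); apply/rowP=> -[j j_lt].
by exfalso; rewrite d0 in j_lt.
Qed.

Lemma redcoH_eq0P i : (forall x : redcoH K C i, x = 0) <-> rbetti C i = 0%N.
Proof.
rewrite -redcoH_dimE; split=> [H0|d0 x].
  apply/eqP; rewrite -leqn0 leqNgt; apply/negP => d_gt0.
  have := H0 (redcoH_vec i (const_mx 1)) => /(congr1 (redcoH_coord i)).
  rewrite redcoH_vecK linear0 => /rowP/(_ (Ordinal d_gt0)) /eqP.
  by rewrite !mxE oner_eq0.
apply: (can_inj (@redcoH_coordK i)); apply/rowP=> -[j j_lt].
by exfalso; rewrite d0 in j_lt.
Qed.

End ReducedBetti.

(** * Exactness of coordinate shifts *)

Section ShiftMatrix.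

Variable K : fieldType.

(* All maps of the exact sequence are of this shape: kill the first r coordinates
   and shift the other ones to the front. *)
Definition shift_mx (r n m : nat) : 'M[K]_(n, m) :=
  \matrix_(i, j) (i == r + j :> nat)%N%:R.

Lemma mul_shift_mx r n m (u : 'rV[K]_n) (j : 'I_m) :
  (u *m shift_mx r n m) 0 j = oapp (u 0) 0 (insub (r + j)%N).
Proof.
rewrite mxE; case: insubP => [k _ kE|nk] /=.
  rewrite (bigD1 k) //= mxE kE eqxx mulr1 big1 ?addr0 // => i ik.
  by rewrite mxE -kE (inj_eq val_inj) (negPf ik) mulr0.
rewrite big1 // => i _; rewrite mxE; case: eqP => [iE|_]; last by rewrite mulr0.
by case/negP: nk; rewrite -iE.
Qed.

(** Kernel and image both consist of the rows supported on the first [s] coordinates: [n - r = s]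
    makes the image fill them, and [m - s <= p] ensures that no later coordinate is truncated
    away. *)
Lemma shift_mx_exact r s n m p : (n - r = s)%N -> (s <= m)%N -> (m - s <= p)%N ->
  forall u : 'rV[K]_m,
    u *m shift_mx s m p = 0 <-> exists v : 'rV_n, v *m shift_mx r n m = u.
Proof.
move=> nrs sm msp u; split=> [us|[v <-]].
  exists (\row_i if (r <= i)%N then oapp (u 0) 0 (insub (i - r)%N) else 0).
  apply/rowP=> j; rewrite mul_shift_mx.
  case: insubP => [k _ kE|nk] /=.
    by rewrite mxE kE leq_addr addKn (insubT (fun x => x < m)%N (ltn_ord j)) /=;
      congr (u _ _); apply: val_inj.
  have sj : (s <= j)%N by move: nk; lia.
  have jp : (j - s < p)%N by have := ltn_ord j; lia.
  have := congr1 (fun w : 'rV_p => w 0 (Ordinal jp)) us.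
  rewrite mul_shift_mx mxE /= subnKC // (insubT (fun x => x < m)%N (ltn_ord j)) /=.
  by move=> <-; congr (u _ _); apply: val_inj.
apply/rowP=> j; rewrite mul_shift_mx [RHS]mxE.
case: insubP => [k _ kE|//] /=; rewrite mul_shift_mx insubN //.
by rewrite kE; lia.
Qed.

Lemma shift_mx_inj r n m : r = 0%N -> (n <= m)%N ->
  injective (fun u : 'rV[K]_n => u *m shift_mx r n m).
Proof.
move=> -> nm u v uv; apply/rowP=> i; have im := leq_trans (ltn_ord i) nm.
have := congr1 (fun w : 'rV_m => w 0 (Ordinal im)) uv.
rewrite !mul_shift_mx /= add0n (insubT (fun x => x < n)%N (ltn_ord i)) /=.
by rewrite (_ : Sub _ _ = i) //; apply: val_inj.
Qed.

Lemma shift_mx_surj r n m : (m <= n - r)%N ->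
  forall v : 'rV[K]_m, exists u : 'rV[K]_n, u *m shift_mx r n m = v.
Proof.
move=> mnr v.
exists (\row_i if (r <= i)%N then oapp (v 0) 0 (insub (i - r)%N) else 0).
apply/rowP=> j; rewrite mul_shift_mx; have rj : (r + j < n)%N.
  by have := ltn_ord j; lia.
rewrite (insubT (fun x => x < n)%N rj) /= mxE /= leq_addr addKn.
rewrite (insubT (fun x => x < m)%N (ltn_ord j)) /=.
by congr (v _ _); apply: val_inj.
Qed.

End ShiftMatrix.

(** * Strong connectivity of normal pseudomanifolds *)

Lemma fdim_eq_subset (V : finType) (s t : {set V}) :
  s \subset t -> fdim t <= fdim s -> s = t.
Proof.
by move=> st; rewrite /fdim => ts; apply/eqP; rewrite eqEcard st; lia.
Qed.

Section PseudoManifold.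

Variables (K : fieldType) (V : finType) (d : nat) (C : simplicial_complex V).
Hypothesis npm : normal_pseudomanifold d C.
Implicit Types (s t F G : {set V}).

Local Notation inc := (incidence K).
Local Notation dim_ := (@fdim V).
Local Notation tops s := (lev dim_ (star (faces C) s) d%:Z).

Lemma in_tops s F :
  (F \in tops s) = [&& F \in faces C, fdim F == d%:Z & s \subset F].
Proof. by rewrite in_lev in_star -andbA [(s \subset F) && _]andbC. Qed.

Lemma face_in_facet s : s \in faces C -> exists2 F, F \in facets C & s \subset F.
Proof.
move=> sC; pose P t := (t \in faces C) && (s \subset t).
have Ps : P s by rewrite /P sC subxx.
case: (arg_maxnP (fun t => #|t|) Ps) => F /andP[FC sF] Fmax.
exists F => //; rewrite inE FC; apply/forall_inP => t tC; apply/implyP => Ft.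
by rewrite eq_sym eqEcard Ft; apply: Fmax; rewrite /P tC (subset_trans sF Ft).
Qed.

Lemma face_in_top s : s \in faces C -> exists F, F \in tops s.
Proof.
move=> sC; have [[_ dF] _ _] := npm; have [F FC sF] := face_in_facet sC.
exists F; rewrite in_tops sF dF // eqxx !andbT.
by move: FC; rewrite inE => /andP[].
Qed.

Lemma fdim_face_le s : s \in faces C -> fdim s <= d%:Z.
Proof.
case/face_in_top => F; rewrite in_tops => /and3P[_ /eqP <- /subset_leq_card].
by rewrite /fdim; lia.
Qed.

Lemma top_facets : [set F in faces C | fdim F == d%:Z] = facets C.
Proof.
have [[_ dF] _ _] := npm.
apply/setP=> F; rewrite !inE; case: (boolP (F \in faces C)) => //= FC.
apply/idP/idP => [/eqP dFd|Fmax]; last first.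
  by rewrite dF // inE FC.
apply/forall_inP => t tC; apply/implyP => Ft.
by rewrite (fdim_eq_subset Ft) // dFd fdim_face_le.
Qed.

(** Induction on the codimension of [s]. From codimension two on, the link is connected, and along
    an edge path in it one passes between the stars of [v |: s], to each of which the induction
    applies. A propagated property [Q] replaces explicit chains of facets. *)
Lemma strongly_connected (Q : {set V} -> Prop) s :
  (forall t F G, t \in faces C -> fdim t = d%:Z - 1 -> s \subset t ->
     F \in tops t -> G \in tops t -> Q F -> Q G) ->
  s \in faces C -> forall F G, F \in tops s -> G \in tops s -> Q F -> Q G.
Proof.
move=> Qadj sC; have [m sm] : exists m : nat, fdim s + m%:Z = d%:Z.
  by have := fdim_face_le sC; exists `|d%:Z - fdim s|%N; lia.
(* In codimension 0 the only facet is [s]; in codimension 1 the face [s] is itself a ridge, and the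
   hypothesis on [Q] applies directly. *)
elim: m s sm sC Qadj => [|[|m] IHm] s sm sC Qadj F G Fs Gs QF.
- have sT H : H \in tops s -> s = H.
    rewrite in_tops => /and3P[_ /eqP dH sH]; apply: fdim_eq_subset => //.
    by rewrite dH -sm addr0.
  by rewrite -(sT G Gs) (sT F Fs).
- by apply: (Qadj s F G) => //; lia.
have [_ /(_ s sC) conn _] := npm.
have {}conn : connected_complex (link C s) by apply: conn; lia.
have outside H : H \in tops s -> exists v, v \notin s /\ v |: s \subset H.
  rewrite in_tops => /and3P[_ /eqP dH sH].
  have : ~~ (H \subset s).
    by apply/negP => /subset_leq_card; move: dH sm; rewrite /fdim; lia.
  by case/subsetPn => v vH vs; exists v; rewrite subUset sub1set vH.
have IHv v : v \notin s -> v |: s \in faces C ->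
    forall H H', H \in tops (v |: s) -> H' \in tops (v |: s) -> Q H -> Q H'.
  move=> vs vsC H H' Hv Hv'; apply: (IHm (v |: s)) => //.
    by rewrite fdim_setU1 //; lia.
  move=> t F' G' tC dt vst; apply: Qadj => //.
  by apply: subset_trans vst; apply: subsetUr.
have [v [vs vF]] := outside F Fs; have [w [ws wG]] := outside G Gs.
have sub_tops t (u H : {set V}) : H \in tops t -> u \subset H -> H \in tops u.
  by rewrite !in_tops => /and3P[-> -> _] ->.
have tops_face t H : H \in tops t -> t \in faces C.
  by rewrite in_tops => /and3P[HC _]; apply: faces_closed HC.
have Fv := sub_tops _ _ _ Fs vF; have Gw := sub_tops _ _ _ Gs wG.
have in_link u : u \notin s -> u |: s \in faces C -> [set u] \in faces (link C s).
  move=> us usC; rewrite inE usC (faces_closed usC (subsetUl _ _)) /=.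
  by rewrite setI_eq0 disjoints1.
have /connectP[p pP wE] := conn v w (in_link v vs (tops_face _ _ Fv))
  (in_link w ws (tops_face _ _ Gw)).
elim: p v F vs vF Fs QF Fv pP wE => [|u p IHp] v F vs vF Fs QF Fv /=.
  by move=> _ wE; apply: (IHv v vs (tops_face _ _ Fv) F) => //; rewrite -wE.
case/andP=> vu pP wE; move: vu; rewrite /adjacent /= inE => /and3P[_ uvC uvs].
have us : u \notin s.
  apply: contraTN uvs => us; apply/set0Pn; exists u.
  by rewrite !inE eqxx orbT.
(* A facet [H] above the edge joined with [s] lies in the stars of both [v |: s] and [u |: s]. *)
have [H HT] := face_in_top uvC.
have Hv : H \in tops (v |: s).
  by apply: (sub_tops _ _ _ HT); move: HT; rewrite in_tops => /and3P[_ _];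
    apply: subset_trans; apply: setSU; rewrite sub1set !inE eqxx.
have Hu : H \in tops (u |: s).
  by apply: (sub_tops _ _ _ HT); move: HT; rewrite in_tops => /and3P[_ _];
    apply: subset_trans; apply: setSU; rewrite sub1set !inE eqxx orbT.
have usH : u |: s \subset H by move: Hu; rewrite in_tops => /and3P[].
apply: (IHp u H us usH _ _ Hu) => //.
  by apply: (sub_tops _ _ _ Hu); apply: subset_trans usH; apply: subsetUr.
by apply: (IHv v vs (tops_face _ _ Fv) F).
Qed.

(** At a ridge the cycle condition has two terms with nonzero incidence, so a zero of [x] passes
    from one facet to the other, and strong connectivity spreads it over the star. *)
Lemma top_cycle_eq0 s (x : {set V} -> K) F0 :
  s \in faces C ->
  (forall t, t \in faces C -> fdim t = d%:Z - 1 -> s \subset t ->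
     \sum_(F in tops s) x F * inc F t = 0) ->
  F0 \in tops s -> x F0 = 0 -> forall F, F \in tops s -> x F = 0.
Proof.
move=> sC cyc F0s xF0 F1 F1s; move: xF0.
apply: (strongly_connected (Q := fun F => x F = 0) _ sC F0s F1s).
move=> t F G tC dt st Ft Gt xF; have [<-//|FG] := eqVneq F G.
have [_ _ /(_ t tC dt) card2] := npm.
have SE : [set F; G] = [set H in faces C | (fdim H == d%:Z) && (t \subset H)].
  apply/eqP; rewrite eqEcard card2 cards2 FG andbT.
  by apply/subsetP=> H /set2P[] ->; rewrite inE -in_tops.
have Gs : G \in tops s.
  by move: Gt; rewrite !in_tops => /and3P[-> -> /(subset_trans st) ->].
have := cyc t tC dt st; rewrite (bigD1 G) //= big1 ?addr0 => [/eqP|H].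
  rewrite mulf_eq0 => /orP[/eqP //|].
  rewrite (negPf (incidence_subset_neq0 _ _ _)) //.
    by move: Gt; rewrite in_tops => /and3P[].
  by move: Gt; rewrite in_tops dt subrK => /and3P[_ /eqP].
case/andP; rewrite in_tops => /and3P[HC dH _] HG.
have [->|HF] := eqVneq H F; first by rewrite xF mul0r.
apply/eqP; rewrite mulf_eq0; apply/orP; right; apply: contraNT HF.
move/incidence_subset => tH; have : H \in [set F; G] by rewrite SE inE HC dH.
by case/set2P => [->|HGE]; [rewrite eqxx | rewrite HGE eqxx in HG].
Qed.

(** A relation among the rows, extended by zero, is a top cycle above [s] that vanishes at the
    omitted facet [F0], hence is trivial. *)
Lemma top_rank s F0 (a b : {set {set V}}) :
  s \in faces C -> F0 \in tops s -> a \subset tops s -> F0 \notin a ->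
  (forall F t, F \in a -> t \subset F -> s \subset t -> fdim t = d%:Z - 1 ->
     t \in b) ->
  \rank (smx inc a b) = #|a|.
Proof.
move=> sC F0s /subsetP aT F0a ab; apply: rank_smx_rows => f fD F Fa.
pose x G := if G \in a then f G else 0.
suff : x F = 0 by rewrite /x Fa.
apply: (top_cycle_eq0 sC _ F0s) (aT F Fa); last by rewrite /x (negPf F0a).
move=> t tC dt st.
have -> : \sum_(G in tops s) x G * inc G t = \sum_(G in a) f G * inc G t.
  rewrite (bigID (mem a)) /= [X in _ + X]big1 ?addr0 => [|G /andP[_ Ga]].
    apply: eq_big => [G|G /andP[_ Ga]]; last by rewrite /x Ga.
    by rewrite andbC; case: (boolP (G \in a)) => // /aT ->.
  by rewrite /x (negPf Ga) mul0r.
case: (boolP (t \in b)) => [/fD //|tb]; rewrite big1 // => G Ga.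
apply/eqP; rewrite mulf_eq0; apply/orP; right; apply: contraNT tb.
by move/incidence_subset => tG; apply: (ab G).
Qed.

(** A nonzero top Betti number yields a nonzero cycle; if it vanished at one facet, it would vanish
    at all of them. *)
Lemma fundamental_cycle : rbetti K C d%:Z != 0%N ->
  exists mu : {set V} -> K,
    (forall F, F \in facets C -> mu F != 0) /\
    (forall t, t \in faces C -> fdim t = d%:Z - 1 ->
       \sum_(F in facets C) mu F * inc F t = 0).
Proof.
have lvl : lev dim_ (faces C) d%:Z = facets C by rewrite -top_facets.
rewrite /rbetti /betti => b0.
have : (brank inc dim_ (faces C) d%:Z < #|lev dim_ (faces C) d%:Z|)%N by lia.
case/smx_kernel => mu [[F0]]; rewrite lvl => F0C muF0 cyc.
have cyc' t : t \in faces C -> fdim t = d%:Z - 1 ->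
    \sum_(F in facets C) mu F * inc F t = 0.
  by move=> tC dt; apply: cyc; rewrite in_lev tC dt eqxx.
exists mu; split=> // F FC; apply: contraNneq muF0 => muF.
have T0 G : (G \in tops set0) = (G \in facets C).
  by rewrite in_tops sub0set andbT -top_facets inE.
have C0 : set0 \in faces C.
  by move: F0C; rewrite inE => /andP[/faces_closed C0 _]; apply: C0 (sub0set _).
apply/eqP; apply: (top_cycle_eq0 (s := set0) (F0 := F) (x := mu)); rewrite ?T0 //.
move=> t tC dt _; rewrite -[RHS](cyc' t tC dt).
by apply: eq_bigl => G; rewrite T0.
Qed.

(** The two endpoint incidences are opposite because the boundary squares to zero down to the empty
    face, so only the difference of [f] along the edge enters. *)
Lemma sum_edge (f : {set V} -> K) v w : [set v; w] \in faces C -> v != w ->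
  \sum_(t in lev dim_ (faces C) 0) f t * inc [set v; w] t =
  (f [set v] - f [set w]) * inc [set v; w] [set v].
Proof.
move=> eC vw.
have lv u : u \in [set v; w] -> [set u] \in lev dim_ (faces C) 0.
  move=> ue; rewrite in_lev (faces_closed eC) ?sub1set //.
  by rewrite /fdim cards1.
have sumE (h : {set V} -> K) :
    \sum_(t in lev dim_ (faces C) 0) h t * inc [set v; w] t =
    h [set v] * inc [set v; w] [set v] + h [set w] * inc [set v; w] [set w].
  rewrite (bigD1 [set v]) ?lv ?set21 //= (bigD1 [set w]) /=; last first.
    by rewrite lv ?set22 //= (inj_eq set1_inj) eq_sym.
  rewrite big1 ?addr0 // => t /andP[/andP[]]; rewrite in_lev => /andP[_ dt] tv tw.
  apply/eqP; rewrite mulf_eq0; apply/orP; right; apply/negP => /negP.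
  move/incidence_subset => te; have /cards1P[u tu] : #|t| == 1%N.
    by move: dt; rewrite /fdim; lia.
  move: te tv tw; rewrite tu sub1set !(inj_eq set1_inj) in_set2.
  by case/orP=> ->.
have inc0 u : inc [set u] set0 = 1.
  rewrite -[X in inc X _]setU0 incidence_setU1 ?inE // /rank_below.
  rewrite (_ : [set _ in _ | _] = set0) ?cards0 //.
  by apply/setP=> z; rewrite !inE.
have := sumE (fun t => inc t set0); rewrite !inc0 !mul1r.
have cC := incidence_complex K (@convex_complex _ C).
have e1 : fdim [set v; w] = 0 + 1 by rewrite /fdim cards2 vw.
under eq_bigr do rewrite mulrC.
rewrite (lev_sum cC) //; last by apply: faces_closed eC (sub0set _).
move/eqP; rewrite eq_sym addrC addr_eq0 => /eqP e2.
by rewrite sumE e2 mulrN mulrBl.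
Qed.

(** As [1 <= d], the link condition holds at the empty face and makes the complex connected. So the
    edge boundary has rank at least the number of vertices minus one, and the augmentation takes the
    remaining dimension. *)
Lemma betti0_eq0 : (1 <= d)%N -> rbetti K C 0 = 0%N.
Proof.
move=> d1; have [_ conn _] := npm.
have [/eqP no0|] := eqVneq (lev dim_ (faces C) 0) set0.
  by rewrite /rbetti /betti (eqP no0) cards0.
case/set0Pn => s0; rewrite in_lev => /andP[s0C ds0].
have /cards1P[v0 s0E] : #|s0| == 1%N by move: ds0; rewrite /fdim; lia.
rewrite {s0}s0E in s0C ds0.
have C0 : set0 \in faces C by apply: faces_closed s0C (sub0set _).
have v0l : [set v0] \in lev dim_ (faces C) 0 by rewrite in_lev s0C.
have r0 : (0 < brank inc dim_ (faces C) 0)%N.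
  apply: (rank_smx_gt0 (y := set0) v0l); first by rewrite in_lev C0 /fdim cards0.
  by rewrite -[X in inc X _]setU0 incidence_setU1_neq0 ?inE.
have connC : connected_complex C.
  have linkE : faces (link C set0) = faces C.
    by apply/setP=> t; rewrite inE setU0 setI0 eqxx andbT andbb.
  have /(_ set0 C0) := conn; rewrite /fdim cards0 => /(_ ltac:(lia)) connL x y.
  move=> xC yC; rewrite -(eq_connect (e := adjacent (link C set0))).
    by apply: connL; rewrite linkE.
  by move=> u w; rewrite /adjacent -linkE.
(* Dropping a base vertex removes the constants: a relation extended by zero at [v0] is constant
   along edge paths, hence zero. *)
pose a := lev dim_ (faces C) 0 :\ [set v0].
suff r1 : \rank (smx inc (lev dim_ (faces C) 1) a) = #|a|.
  have := rank_smxS inc (subxx (lev dim_ (faces C) 1))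
    (subsetDl (lev dim_ (faces C) 0) [set [set v0]]).
  rewrite -/a r1 /rbetti /betti -brank_succ add0r.
  have := cardsD1 [set v0] (lev dim_ (faces C) 0); rewrite v0l -/a.
  lia.
rewrite -rank_smx_tr; apply: rank_smx_rows => f fD s sa.
pose f' t := if t \in a then f t else 0.
have sumE e : \sum_(t in lev dim_ (faces C) 0) f' t * inc e t =
    \sum_(t in a) f t * inc e t.
  rewrite (bigD1 [set v0]) //= {1}/f' !inE eqxx /= mul0r add0r.
  apply: eq_big => [t|t /andP[tl tv]]; first by rewrite !inE andbC.
  by rewrite /f' in_setD1 tl tv.
suff: f' s = f' [set v0] by rewrite /f' sa !inE eqxx.
move: (sa); rewrite in_setD1 in_lev => /and3P[_ sC ds].
have /cards1P[v sE] : #|s| == 1%N by move: ds; rewrite /fdim; lia.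
rewrite {s sa ds}sE in sC *.
have /connectP[p pP ->] := connC v v0 sC s0C.
elim: p v pP {sC} => [//|u p IHp] v /= /andP[vu /IHp <-].
have [->//|neq_vu] := eqVneq v u.
have vuC : [set v; u] \in faces C by [].
have := sum_edge f' vuC neq_vu; rewrite sumE fD; last first.
  by rewrite in_lev vuC /fdim cards2 neq_vu.
move/esym/eqP; rewrite mulf_eq0 subr_eq0 => /orP[/eqP //|].
rewrite (negPf (incidence_subset_neq0 _ _ _)) ?sub1set ?set21 //.
by rewrite /fdim cards2 neq_vu cards1.
Qed.

End PseudoManifold.

(** * The duality complex *)

Lemma betti_set1 (K : fieldType) (I : finType) (D : I -> I -> K)
  (g : I -> int) x n : betti D g [set x] n = (n == g x).
Proof.
have levE m : lev g [set x] m = if m == g x then [set x] else set0.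
  apply/setP=> y; rewrite in_lev in_set1.
  case: (eqVneq y x) => [->|yx] /=; last by case: ifP; rewrite ?inE ?(negPf yx).
  by rewrite eq_sym; case: ifP; rewrite ?inE ?eqxx.
have b0 m : brank D g [set x] m = 0%N.
  rewrite /brank !levE; case: eqP => [->|_].
    rewrite ifN; last by apply/negP; lia.
    by apply/eqP; rewrite -leqn0 (leq_trans (rank_smx_le2 _ _ _)) ?cards0.
  by apply/eqP; rewrite -leqn0 (leq_trans (rank_smx_le _ _ _)) ?cards0.
by rewrite /betti !b0 !subn0 levE; case: eqP => _; rewrite ?cards1 ?cards0.
Qed.

Lemma sum_kdelta (K : fieldType) (I : finType) (x : I) (F : I -> K) :
  \sum_y (x == y)%:R * F y = F x.
Proof.
rewrite (bigD1 x) //= eqxx mul1r big1 ?addr0 // => y yx.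
by rewrite eq_sym (negPf yx) mul0r.
Qed.

Section TensorComplex.

Variables (K : fieldType) (I J : finType).
Variables (D1 : I -> I -> K) (D2 : J -> J -> K) (e : I -> K).

(** The factor [e] is the Koszul sign, which has to flip along [D1]. *)
Definition tensor_diff (x y : I * J) : K :=
  (x.2 == y.2)%:R * D1 x.1 y.1 + (x.1 == y.1)%:R * (e x.1 * D2 x.2 y.2).

Lemma tensor_diff_neq0 x y : tensor_diff x y != 0 ->
  x.2 = y.2 /\ D1 x.1 y.1 != 0 \/ x.1 = y.1 /\ D2 x.2 y.2 != 0.
Proof.
rewrite /tensor_diff; have [xy2|_] := eqVneq x.2 y.2; last rewrite mul0r add0r.
  have [->|D1xy] := eqVneq (D1 x.1 y.1) 0; last by left.
  have [xy1|_] := eqVneq x.1 y.1; last by rewrite mulr0 mul0r addr0 eqxx.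
  by rewrite mulr0 add0r mul1r mulf_eq0 negb_or => /andP[_ ?]; right.
have [xy1|_] := eqVneq x.1 y.1; last by rewrite mul0r eqxx.
by rewrite mul1r mulf_eq0 negb_or => /andP[_ ?]; right.
Qed.

Lemma tensor_diff_square x z :
  (forall s s', \sum_y D1 s y * D1 y s' = 0) ->
  (forall t t', \sum_y D2 t y * D2 y t' = 0) ->
  (forall s s', D1 s s' != 0 -> e s' = - e s) ->
  \sum_y tensor_diff x y * tensor_diff y z = 0.
Proof.
case: x z => [s t] [s' t'] sq1 sq2 anti.
rewrite -(pair_bigA _ (fun i j =>
  tensor_diff (s, t) (i, j) * tensor_diff (i, j) (s', t'))) /tensor_diff /=.
have inner i : \sum_j
    ((t == j)%:R * D1 s i + (s == i)%:R * (e s * D2 t j)) *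
    ((j == t')%:R * D1 i s' + (i == s')%:R * (e i * D2 j t')) =
  (t == t')%:R * (D1 s i * D1 i s') +
  (s' == i)%:R * (D1 s i * e i * D2 t t') +
  (s == i)%:R * (e s * D2 t t' * D1 i s').
  transitivity (\sum_j ((t == j)%:R * (D1 s i * ((j == t')%:R * D1 i s' +
      (i == s')%:R * (e i * D2 j t'))) +
    ((t' == j)%:R * ((s == i)%:R * (e s * D2 t j * D1 i s')) +
     (s == i)%:R * (i == s')%:R * (e s * e i) * (D2 t j * D2 j t')))).
    by apply: eq_bigr => j _; rewrite [t' == j]eq_sym; ring.
  rewrite !big_split /= !sum_kdelta -mulr_sumr sq2 mulr0 addr0 [i == s']eq_sym.
  by ring.
under eq_bigr do rewrite inner.
rewrite !big_split /= !sum_kdelta -mulr_sumr sq1 mulr0 add0r.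
(* Only the two mixed terms remain, with factors [e s'] and [e s]; they cancel by the sign rule. *)
have [->|/anti ->] := eqVneq (D1 s s') 0; first by rewrite !mul0r mulr0 addr0.
by ring.
Qed.

End TensorComplex.

Lemma is_complexT_sub (K : fieldType) (I : finType) (D : I -> I -> K)
    (g : I -> int) (X : {set I}) :
  is_complex D g [set: I] ->
  (forall x y z, x \in X -> z \in X -> D x y != 0 -> D y z != 0 -> y \in X) ->
  is_complex D g X.
Proof.
move=> cT convX; apply: sub_complex cT (subsetT X) _ => x y z xX zX _ yX.
apply/eqP; rewrite mulf_eq0; apply: contraNT yX; rewrite negb_or.
by case/andP; apply: convX.
Qed.

Section Duality.

Variables (K : fieldType) (V : finType) (d : nat).
Variables (C CA CB : simplicial_complex V).
Hypothesis npm : normal_pseudomanifold d C.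

Local Notation inc := (incidence K).
Local Notation dim_ := (@fdim V).
Local Notation bt := (betti inc dim_).
Local Notation tops s := (lev dim_ (star (faces C) s) d%:Z).

Hypothesis CAB : forall s, (s \in faces C) = (s \in faces CA) || (s \in faces CB).
Hypothesis pureA : forall s, s \in faces CA ->
  exists2 F, F \in tops s & F \in faces CA.
Hypothesis pureB : forall s, s \in faces CB ->
  exists2 F, F \in tops s & F \in faces CB.
Hypothesis topAB : forall F, F \in facets C -> F \in faces CA -> F \notin faces CB.
Hypothesis bbA : forall s m, s \in faces CA -> s != set0 -> m < d%:Z ->
  bt (star (faces CA) s) m = 0%N.
Variable mu : {set V} -> K.
Hypothesis mu_neq0 : forall F, F \in facets C -> mu F != 0.
Hypothesis mu_cycle : forall t, t \in faces C -> fdim t = d%:Z - 1 ->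
  \sum_(F in facets C) mu F * inc F t = 0.

Let subA s : s \in faces CA -> s \in faces C. Proof. by rewrite CAB => ->. Qed.
Let subB s : s \in faces CB -> s \in faces C.
Proof. by rewrite CAB orbC => ->. Qed.

(** * Homology of stars in top degree *)

Lemma facetsE F : (F \in facets C) = (F \in faces C) && (fdim F == d%:Z).
Proof. by rewrite -(top_facets npm) inE. Qed.

Lemma tops_facet s F : F \in tops s -> F \in facets C.
Proof. by rewrite in_tops facetsE => /and3P[-> ->]. Qed.

Lemma betti_star_gt (X : simplicial_complex V) s m :
  (forall t, t \in faces X -> t \in faces C) -> d%:Z < m ->
  bt (star (faces X) s) m = 0%N.
Proof.
move=> XC dm; rewrite /betti (_ : lev _ _ _ = set0) ?cards0 //.
apply/setP=> t; rewrite in_lev in_star in_set0.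
apply/negP => /andP[/andP[/XC tC _] /eqP dt].
by have := fdim_face_le npm tC; lia.
Qed.

Lemma top_star_sub (X : simplicial_complex V) s :
  (forall t, t \in faces X -> t \in faces C) ->
  lev dim_ (star (faces X) s) d%:Z \subset tops s.
Proof.
move=> XC; apply/subsetP=> F; rewrite in_lev in_star in_tops.
by case/andP=> /andP[/XC -> ->] ->.
Qed.

Lemma betti_star_top (X : simplicial_complex V) s F0 :
  (forall t, t \in faces X -> t \in faces C) ->
  s \in faces C -> F0 \in tops s -> F0 \notin faces X ->
  bt (star (faces X) s) d%:Z = 0%N.
Proof.
move=> XC sC F0s F0X; rewrite /betti /brank.
rewrite (top_rank K npm sC F0s) ?subnn ?top_star_sub //.
  by rewrite in_lev in_star (negPf F0X).
move=> F t; rewrite !in_lev !in_star => /andP[/andP[FX _] _] tF -> ->.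
by rewrite (faces_closed FX tF) eqxx.
Qed.

(** In degree [d] the Buchsbaum condition is silent; there a facet of [CB] above [s] is missing from
    [CA], which excludes top cycles. *)
Lemma betti_starA_eq0 s m : s \in faces CA -> s \in faces CB -> s != set0 ->
  bt (star (faces CA) s) m = 0%N.
Proof.
move=> sA sB s0; case: (ltgtP m d%:Z) => [md|md|->]; first exact: bbA.
  exact: betti_star_gt.
have [F Fs FB] := pureB sB; apply: (betti_star_top (F0 := F)) => //.
  exact: subA.
by apply/negP => /topAB; rewrite FB => /(_ (tops_facet Fs)).
Qed.

(** The rows are independent once one facet is omitted, while [mu] restricted to the star is a
    relation between them; so the top cycles form a line. *)
Lemma betti_star_top_eq1 s : s \in faces C -> bt (star (faces C) s) d%:Z = 1%N.
Proof.
move=> sC; have [F0 F0s] := face_in_top npm sC.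
set L := tops s; have cL := cardsD1 F0 L; rewrite F0s add1n in cL.
have rge : (#|L :\ F0| <= brank inc dim_ (star (faces C) s) d%:Z)%N.
  pose b := lev dim_ (star (faces C) s) (d%:Z - 1).
  rewrite -(top_rank K npm sC F0s (a := L :\ F0) (b := b)).
  - by apply: rank_smxS => //; apply: subsetDl.
  - exact: subsetDl.
  - by rewrite !inE eqxx.
  move=> F t /setD1P[_]; rewrite !in_lev !in_star.
  by case/andP=> /andP[FC _] _ tF -> ->; rewrite (faces_closed FC tF) eqxx.
have rle : (brank inc dim_ (star (faces C) s) d%:Z < #|L|)%N.
  (* Here [mu] is a one-row matrix of rank one, annihilated by the boundary. *)
  have := rank_smx_Frobenius (fun (_ : unit) F => mu F) inc [set: unit] L
    (lev dim_ (star (faces C) s) (d%:Z - 1)).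
  rewrite [X in (_ <= _ + X)%N](_ : _ = 0%N); last first.
    rewrite smx0 ?mxrank0 // => _ t _; rewrite in_lev in_star.
    case/andP=> /andP[tC st] /eqP dt; rewrite -[RHS](mu_cycle tC dt).
    rewrite [RHS](bigID (mem L)) /= [X in _ = _ + X]big1 ?addr0.
      apply: eq_bigl => F; rewrite andbC; case: (boolP (F \in L)) => //.
      by move/tops_facet => ->.
    move=> F /andP[]; rewrite facetsE => /andP[FC dF] FL.
    apply/eqP; rewrite mulf_eq0; apply/orP; right; apply: contraNT FL.
    by move/incidence_subset/(subset_trans st); rewrite in_tops FC dF.
  rewrite addn0; apply: leq_trans; rewrite -add1n leq_add2r.
  exact: (rank_smx_gt0 (D := fun _ F => mu F) (in_setT tt) F0s
    (mu_neq0 (tops_facet F0s))).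
have -> : bt (star (faces C) s) d%:Z =
    (#|L| - brank inc dim_ (star (faces C) s) d%:Z)%N.
  rewrite /betti [X in (_ - X)%N](_ : _ = 0%N) ?subn0 //.
  apply/eqP; rewrite -leqn0 (leq_trans (rank_smx_le _ _ _)) // leqn0 cards_eq0.
  apply/eqP/setP=> t; rewrite in_lev in_star in_set0.
  apply/negP => /andP[/andP[tC _] /eqP dt].
  by have := fdim_face_le npm tC; lia.
by lia.
Qed.

(* None stands for a (d+1)-cell attached along the fundamental cycle. *)
Definition ext_diff (t t' : option {set V}) : K :=
  match t, t' with
  | Some a, Some b => inc a b
  | None, Some b => if b \in facets C then mu b else 0
  | _, None => 0
  end.

Definition ext_dim (t : option {set V}) : int :=
  if t is Some a then fdim a else d%:Z + 1.

Lemma sum_option (F : option {set V} -> K) :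
  \sum_t F t = F None + \sum_a F (Some a).
Proof.
rewrite (bigD1 None) //=; congr (_ + _).
rewrite (reindex_omap Some id) => [|[a|]] //.
by apply: eq_bigl => a; rewrite eqxx.
Qed.

Lemma ext_complex : is_complex ext_diff ext_dim setT.
Proof.
split=> [[a|] [b|] _ _ //=|t t' _ _]; rewrite ?eqxx //.
- exact: incidence_fdim.
- by case: ifP => [|_]; [rewrite facetsE => /andP[_ /eqP ->] | rewrite eqxx].
transitivity (\sum_y ext_diff t y * ext_diff y t').
  by apply: eq_bigl => y; rewrite in_setT.
rewrite sum_option; case: t t' => [a|] [b|] /=;
  rewrite ?mul0r ?mulr0 ?add0r //; last 2 first.
- have [tC|bC] := boolP ((b \in faces C) && (fdim b == d%:Z - 1)).
    case/andP: tC => bC /eqP db; rewrite -[RHS](mu_cycle bC db) [RHS]big_mkcond.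
    by apply: eq_bigr => F _; case: ifP => _; rewrite ?mul0r.
  rewrite big1 // => F _; case: ifP => [|_]; last by rewrite mul0r.
  rewrite facetsE => /andP[FC /eqP dF]; apply/eqP; rewrite mulf_eq0.
  apply/orP; right; apply: contraNT bC => nz.
  rewrite (faces_closed FC (incidence_subset nz)) /=.
  by have := incidence_fdim nz; rewrite dF; lia.
- by rewrite big1 // => F _; rewrite mulr0.
- exact: incidence_square.
- by rewrite big1 // => F _; rewrite mulr0.
Qed.

(* Above s the cell None is present exactly when all facets of C containing s
   belong to CA. *)
Definition ext_above (s : {set V}) (t : option {set V}) : bool :=
  if t is Some a then (a \in faces CA) && (s \subset a)
  else (s \in faces C) && (s \notin faces CB).

(** The delicate case descends from [None] to a facet above [s]: that facet is in [CA], since in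
    [CB] it would bring [s] into [CB]. *)
Lemma ext_aboveP s x y z : ext_above s x -> ext_above s z ->
  ext_diff x y != 0 -> ext_diff y z != 0 -> ext_above s y.
Proof.
case: y => [b|]; last by case: x => [?|] /=; rewrite eqxx.
case: z => [c|]; last by rewrite /= eqxx.
move=> sx /= /andP[_ sc] xb /incidence_subset cb.
have sb := subset_trans sc cb; rewrite sb andbT.
case: x sx xb => [a|] /=.
  by case/andP=> aA _ /incidence_subset; apply: faces_closed.
case/andP=> _ sB; case: ifP => [|_]; last by rewrite eqxx.
rewrite facetsE CAB => /andP[/orP[//|bB] _] _; case/negP: sB.
exact: faces_closed bB sb.
Qed.

Definition ext_star s : {set option {set V}} := [set t | ext_above s t].

Lemma ext_star_complex s : is_complex ext_diff ext_dim (ext_star s).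
Proof.
apply: is_complexT_sub ext_complex _ => x y z; rewrite !inE.
exact: ext_aboveP.
Qed.

Lemma betti_Some (X : {set {set V}}) n :
  betti ext_diff ext_dim [set Some a | a in X] n = bt X n.
Proof.
rewrite -[n in LHS]addr0.
apply: (betti_reindex (e := fun=> 1) (e' := fun=> 1)).
- by move=> a b _ _ [].
- by move=> a _; rewrite /= addr0.
- by move=> *; apply: oner_neq0.
- by move=> *; apply: oner_neq0.
- by move=> a b _ _; rewrite !mul1r.
Qed.

Lemma ext_star_Some s : s \in faces CB ->
  ext_star s = [set Some a | a in star (faces CA) s].
Proof.
move=> sB; apply/setP=> -[a|]; rewrite inE /=; last first.
  by rewrite sB andbF; apply/esym/negbTE/imsetP => -[].
rewrite -in_star; apply/idP/imsetP => [aX|[b bX [->]] //].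
by exists a.
Qed.

(** All faces above [s] lie in [CA], so the star is that of [C], with a single class, in degree [d].
    The cell [None] is attached along this class, and the two cancel. *)
Lemma betti_ext_star_open s m : s \in faces C -> s \notin faces CB ->
  s != set0 -> betti ext_diff ext_dim (ext_star s) m = 0%N.
Proof.
move=> sC sB s0; have sA : s \in faces CA.
  by move: sC; rewrite CAB (negPf sB) orbF.
set X := ext_star s; pose Z := [set Some a | a in star (faces CA) s].
have cX : is_complex ext_diff ext_dim X by apply: ext_star_complex.
have XN : None \in X by rewrite inE /= sC sB.
have XS a : (Some a \in X) = (a \in star (faces CA) s) by rewrite inE in_star.
have ZS a : (Some a \in Z) = (a \in star (faces CA) s).
  by apply/imsetP/idP => [[b bX [->]] //|aX]; exists a.
have ZN : None \notin Z by apply/imsetP => -[].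
have ZX : Z \subset X by apply/subsetP=> -[a|]; rewrite ?ZS ?XS // (negPf ZN).
have UE : X :\: Z = [set None].
  by apply/setP=> -[a|]; rewrite in_setD in_set1 ?XN ?ZN // XS ZS andNb.
have DZ x y : x \in Z -> y \in X :\: Z -> ext_diff x y = 0.
  by rewrite UE in_set1 => _ /eqP ->; case: x.
have les := betti_les cX ZX DZ.
have bZ n : betti ext_diff ext_dim Z n = bt (star (faces CA) s) n.
  exact: betti_Some.
have bU n : betti ext_diff ext_dim (X :\: Z) n = (n == d%:Z + 1).
  by rewrite UE betti_set1.
have starE : star (faces CA) s = star (faces C) s.
  apply/setP=> t; rewrite !in_star CAB; case: (boolP (s \subset t)) => st.
    have /negPf -> : t \notin faces CB; last by rewrite orbF.
    by apply: contra sB => /faces_closed; apply.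
  by rewrite !andbF.
have [F0 F0s] := face_in_top npm sC.
have bZd : bt (star (faces CA) s) d%:Z = 1%N.
  by rewrite starE betti_star_top_eq1.
(* The boundary of [None] has the nonzero coefficient [mu F0] at [F0], so the connecting map is not
   zero. *)
have crank1 : (0 < crank ext_diff ext_dim X Z (d%:Z + 1))%N.
  have rX : (0 < brank ext_diff ext_dim X (d%:Z + 1))%N.
    apply: (rank_smx_gt0 (x := None) (y := Some F0)).
    - by rewrite in_lev XN /= eqxx.
    - by rewrite in_lev XS starE addrK; move: F0s; rewrite in_lev.
    - by rewrite /= (tops_facet F0s) mu_neq0 // (tops_facet F0s).
  have rU : brank ext_diff ext_dim (X :\: Z) (d%:Z + 1) = 0%N.
    apply/eqP; rewrite -leqn0 (leq_trans (rank_smx_le2 _ _ _)) // leqn0 cards_eq0.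
    apply/eqP/setP=> t; rewrite UE in_lev in_set1 in_set0; apply/negP.
    by case/andP=> /eqP -> /=; lia.
  have rZ : brank ext_diff ext_dim Z (d%:Z + 1) = 0%N.
    apply/eqP; rewrite -leqn0 (leq_trans (rank_smx_le _ _ _)) // leqn0 cards_eq0.
    apply/eqP/setP=> -[a|]; rewrite in_lev ?(negPf ZN) in_set0 // ZS in_star.
    by apply/negP => /andP[/andP[/subA /(fdim_face_le npm) ? _] /eqP /= ?]; lia.
  by rewrite /crank rU rZ; lia.
have [md|md|md] := ltgtP m d%:Z.
- by have := les m; rewrite bU bZ (bbA sA s0 md); lia.
- have := les m; rewrite bU bZ (betti_star_gt _ subA md).
  by case: eqP => [->|_]; lia.
- by rewrite md; have := les d%:Z; rewrite bU bZ; lia.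
Qed.

(** The first factor carries the transposed incidence, so [pair_dim] counts the dimension of [s]
    negatively. *)
Definition pair_diff := tensor_diff (fun s s' : {set V} => inc s' s) ext_diff
  (fun s : {set V} => (-1) ^+ #|s|).

Definition pair_dim (x : {set V} * option {set V}) : int :=
  ext_dim x.2 - fdim x.1.

Lemma pair_complexT : is_complex pair_diff pair_dim setT.
Proof.
split=> [x y _ _ /tensor_diff_neq0[[xy /incidence_fdim D]|[xy D]]|x z _ _].
- by rewrite /pair_dim xy D opprD addrA subrK.
- by rewrite /pair_dim xy (ext_complex.1 _ _ (in_setT _) (in_setT _) D); rewrite addrAC.
transitivity (\sum_y pair_diff x y * pair_diff y z).
  by apply: eq_bigl => y; rewrite in_setT.
apply: tensor_diff_square => [s s'|t t'|s s'].
- by rewrite -[RHS](incidence_square K s' s); apply: eq_bigr => y _; rewrite mulrC.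
- rewrite -[RHS](ext_complex.2 t t' (in_setT _) (in_setT _)).
  by apply: eq_bigl => y; rewrite in_setT.
- by case/incidence_neq0 => v vs ->; rewrite cardsU1 vs exprS mulN1r.
Qed.

Lemma pair_diff_fix s t t' :
  pair_diff (s, t) (s, t') = (-1) ^+ #|s| * ext_diff t t'.
Proof.
rewrite /pair_diff /tensor_diff /= eqxx mul1r.
have [->|/incidence_fdim] := eqVneq (inc s s) 0; last by lia.
by rewrite mulr0 add0r.
Qed.

Definition column s : {set {set V} * option {set V}} :=
  [set (s, t) | t in ext_star s].

Lemma betti_column s n :
  betti pair_diff pair_dim (column s) n =
  betti ext_diff ext_dim (ext_star s) (n + fdim s).
Proof.
rewrite -[n in LHS](addrK (fdim s)).
apply: (betti_reindex (e := fun=> (-1) ^+ #|s|) (e' := fun=> 1)).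
- by move=> t t' _ _ [].
- by [].
- by move=> *; rewrite signr_eq0.
- by move=> *; apply: oner_neq0.
- by move=> t t' _ _; rewrite pair_diff_fix mulr1.
Qed.

(** * The double complex over a common face [rho] *)

Variable rho : {set V}.
Hypotheses (rhoA : rho \in faces CA) (rhoB : rho \in faces CB).

Definition pairs : {set {set V} * option {set V}} :=
  [set x : {set V} * option {set V} | (rho \subset x.1) && ext_above x.1 x.2].

Lemma in_pairs s t : ((s, t) \in pairs) = (rho \subset s) && ext_above s t.
Proof. by rewrite inE. Qed.

Lemma pairs_face s t : (s, t) \in pairs -> s \in faces C.
Proof.
rewrite in_pairs => /andP[_]; case: t => [a|] /=; last by case/andP.
by case/andP=> /subA aC; apply: faces_closed.
Qed.

(** Along two steps [s] grows and [t] shrinks, so the middle pair is squeezed between the outer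
    ones; for [None], faces above a face outside [CB] are again outside [CB]. *)
Lemma pairs_complex : is_complex pair_diff pair_dim pairs.
Proof.
apply: is_complexT_sub pair_complexT _ => -[s t] [u y] [s' t'] xX zX Dxy Dyz.
have s'C := pairs_face zX; move: xX zX; rewrite !in_pairs.
case/andP=> rs st /andP[rs' s't'].
have [su us'] : s \subset u /\ u \subset s'.
  split; first by case/tensor_diff_neq0: Dxy => /= [[_ /incidence_subset]|[-> _]].
  by case/tensor_diff_neq0: Dyz => /= [[_ /incidence_subset]|[-> _]].
rewrite (subset_trans rs su) /=.
have uC := faces_closed s'C us'.
have uNone : s \notin faces CB -> u \notin faces CB.
  by apply: contra => uB; apply: faces_closed uB su.
case/tensor_diff_neq0: Dxy => /= [[ty _]|[su' Dty]]; last first.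
  case/tensor_diff_neq0: Dyz => /= [[yt' _]|[us'' Dyt']]; last first.
    by move: s't'; rewrite -us'' -su' => st'; apply: ext_aboveP Dty Dyt'.
  move: s't'; rewrite -yt'; case: (y) Dty => [a|] /=; last first.
    by case: (t) => [?|]; rewrite eqxx.
  by move=> _ /andP[-> s'a]; apply: subset_trans us' s'a.
move: st; rewrite ty; case: y ty Dyz => [a|] ty Dyz /=; last first.
  by case/andP=> _ /uNone ->; rewrite uC.
case/andP=> -> _ /=.
case/tensor_diff_neq0: Dyz => /= [[yt' _]|[us'' Dyt']].
  by move: s't'; rewrite -yt' => /andP[_]; apply: subset_trans.
case: t' s't' Dyt' => [b|] /=; last by rewrite eqxx.
by case/andP=> _ s'b /incidence_subset; exact: subset_trans (subset_trans us' s'b).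
Qed.

(** Pairs with [s] other than [rho] form a subcomplex, filtered so that larger [s] come lower. Its
    columns are acyclic: outside [CB] thanks to [None], in [CA] and [CB] by [betti_starA_eq0], and
    outside [CA] because they are empty. *)
Lemma betti_pairs_columns n :
  betti pair_diff pair_dim pairs n = bt (star (faces CA) rho) (n + fdim rho).
Proof.
pose Z := [set x in pairs | x.1 != rho].
have ZX : Z \subset pairs by apply/subsetP=> x; rewrite inE => /andP[].
have DZ x y : x \in Z -> y \in pairs :\: Z -> pair_diff x y = 0.
  rewrite inE => /andP[]; case: x y => [s t] [s' t'].
  rewrite in_pairs => /andP[rs _] /= sr /setDP[yX].
  rewrite inE yX /= negbK => /eqP s'r.
  apply/eqP; apply: contraNT sr => /tensor_diff_neq0 /= [[_]|[-> _]].
    by rewrite s'r => /incidence_subset sr; rewrite eqEsubset sr rs.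
  by rewrite s'r.
have UE : pairs :\: Z = column rho.
  apply/setP=> -[s t]; rewrite inE [in X in ~~ X]inE.
  apply/idP/imsetP => [/andP[sr stX]|[t' tX [-> ->]]].
    move: sr; rewrite stX /= negbK => /eqP sr; rewrite sr in stX *.
    by exists t; rewrite // inE; move: stX; rewrite in_pairs => /andP[].
  by rewrite /= eqxx andbF in_pairs subxx /=; move: tX; rewrite inE.
have Z0 m : betti pair_diff pair_dim Z m = 0%N.
  apply: (betti_fibers (key := @fst {set V} (option {set V}))
    (f := fun s : {set V} => (#|V| - #|s|)%N)).
  - exact: closed_complex pairs_complex ZX DZ.
  - move=> x y _ _ /tensor_diff_neq0[[_ /incidence_neq0[v vx ->]]|[-> _]]; last by left.
    right; have := subset_leq_card (subsetT (v |: x.1)).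
    by rewrite cardsT !cardsU1 vx add1n => le_V; apply: ltn_sub2l.
  move=> s; case: (boolP [&& rho \subset s, s != rho & s \in faces C]) => [|sN].
    case/and3P=> rs sr sC.
    have -> : [set x in Z | x.1 == s] = column s.
      apply/setP=> -[s1 t]; rewrite !inE /=.
      apply/idP/imsetP => [/andP[/andP[/andP[_ st] _] /eqP s1s]|[t' tX [-> ->]]].
        by rewrite s1s in st *; exists t; rewrite // inE.
      by rewrite rs sr eqxx; move: tX; rewrite inE => ->.
    have s0 : s != set0.
      by apply: contraNneq sr => s0; move: rs; rewrite s0 subset0 eq_sym.
    rewrite betti_column; have [sB|sB] := boolP (s \in faces CB); last first.
      exact: betti_ext_star_open.
    rewrite ext_star_Some // betti_Some; have [sA|sA] := boolP (s \in faces CA).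
      exact: betti_starA_eq0.
    suff -> : star (faces CA) s = set0 by apply: betti_set0.
    apply/setP=> t; rewrite in_star in_set0; apply: contraNF sA => /andP[tA].
    exact: faces_closed.
  suff -> : [set x in Z | x.1 == s] = set0 by apply: betti_set0.
  apply/setP=> -[s1 t]; rewrite inE [in X in X && _]inE in_set0 /=.
  apply: contraNF sN => /andP[/andP[stX s1r] /eqP <-].
  by rewrite s1r (pairs_face stX); move: stX; rewrite in_pairs => /andP[->].
rewrite (betti_closed0 pairs_complex ZX DZ) // UE betti_column.
(* As [rho] lies in [CB], the surviving column has no cell [None]. *)
by rewrite ext_star_Some // betti_Some.
Qed.

(** Indexes the relative cochains of the star in [C] modulo the star in [CB]. *)
Definition open_star : {set {set V}} := star (faces C) rho :\: faces CB.

(** No face has [None] in its differential, so this is a subcomplex, and its complement is the row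
    of [None]. *)
Definition finite_pairs : {set {set V} * option {set V}} :=
  [set x in pairs | x.2 != None].

Let FX : finite_pairs \subset pairs.
Proof. by apply/subsetP=> x; rewrite inE => /andP[]. Qed.

Let DF x y : x \in finite_pairs -> y \in pairs :\: finite_pairs ->
  pair_diff x y = 0.
Proof.
rewrite inE => /andP[_ xN] /setDP[yX]; rewrite inE yX /= negbK => /eqP yN.
case: x y xN yN {yX} => [s [a|]] [s' t] //= _ ->.
by rewrite /pair_diff /tensor_diff /= mul0r add0r !mulr0.
Qed.

(** In this row only [s] varies, with transposed incidence; the reflection [d + 1 - n] of degrees
    comes from the dimension [d + 1] of [None]. *)
Lemma betti_infinite_pairs n :
  betti pair_diff pair_dim (pairs :\: finite_pairs) n =
  bt open_star (d%:Z + 1 - n).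
Proof.
have -> : pairs :\: finite_pairs = [set (s, None) | s in open_star].
  apply/setP=> -[s t]; rewrite inE [in X in ~~ X]inE.
  case: t => [a|] /=.
    by rewrite andbT andNb; apply/esym/negbTE/imsetP => -[].
  rewrite andbF in_pairs /=.
  apply/idP/imsetP => [/and3P[rs sC sB]|[s' + [->]]].
    by exists s; rewrite // in_setD sB in_star sC.
  by rewrite in_setD in_star => /and3P[-> -> ->].
have nE : n = - (d%:Z + 1 - n) + (d%:Z + 1) by lia.
rewrite [in LHS]nE -(betti_dual inc).
apply: (betti_reindex (e := fun=> 1) (e' := fun=> 1)).
- by move=> s s' _ _ [].
- by move=> s _; rewrite /pair_dim /=; lia.
- by move=> *; apply: oner_neq0.
- by move=> *; apply: oner_neq0.
- by move=> s s' _ _; rewrite /pair_diff /tensor_diff /= !mulr0 addr0 mul1r !mul1r.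
Qed.

(** For fixed [t] other than [rho] the row is a transposed Boolean interval from [rho] to [t], hence
    acyclic. What survives is [rho] paired with itself. *)
Lemma betti_finite_pairs n :
  betti pair_diff pair_dim finite_pairs n = (n == 0).
Proof.
have cF := closed_complex pairs_complex FX DF.
pose Z := [set (rho, Some rho)].
have ZF : Z \subset finite_pairs.
  by rewrite sub1set !inE /= !subxx rhoA.
have DZ x y : x \in Z -> y \in finite_pairs :\: Z -> pair_diff x y = 0.
  rewrite in_set1 => /eqP ->; rewrite inE in_set1 => /andP[yr].
  rewrite inE => /andP[yX yN]; apply/eqP; apply: contraNT yr.
  case: y yX yN => s [a|] //=; rewrite in_pairs => /and3P[rs _ sa] _.
  case/tensor_diff_neq0 => /= [[[ar]]|[sr /incidence_subset ar]].
    by move=> _; rewrite -ar in sa *; rewrite xpair_eqE eqxx andbT eqEsubset rs sa.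
  by rewrite -sr in sa *; rewrite xpair_eqE eqxx /= (inj_eq Some_inj) eqEsubset sa ar.
have U0 m : betti pair_diff pair_dim (finite_pairs :\: Z) m = 0%N.
  apply: (betti_fibers (key := @snd {set V} (option {set V}))
    (f := oapp (fun a : {set V} => #|a|) 0%N)).
  - exact: open_complex cF DZ.
  - move=> [s [a|]] [s' [b|]] /setDP[+ _] /setDP[+ _]; rewrite !inE ?andbF //=.
    move=> _ _ /tensor_diff_neq0 /= [[-> _]|[_ /incidence_neq0[v vb ->]]].
      by left.
    by right; rewrite cardsU1 vb.
  move=> [t|]; last first.
    suff -> : [set x in finite_pairs :\: Z | x.2 == None] = set0.
      exact: betti_set0.
    by apply/setP=> -[s [a|]]; rewrite !inE /= ?andbF.
  case: (boolP [&& rho \subset t, t != rho & t \in faces CA]) => [|tN].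
    case/and3P=> rt tr tA.
    have -> : [set x in finite_pairs :\: Z | x.2 == Some t] =
        [set (s, Some t) | s in star [set s : {set V} | s \subset t] rho].
      apply/setP=> -[s t']; apply/idP/imsetP => [|[s' sX [-> ->]]].
        rewrite !inE /= => /andP[/andP[_ /andP[/andP[rs st] _]] /eqP tE].
        by rewrite tE in st *; exists s; rewrite // !inE rs; case/andP: st => _ ->.
      move: sX; rewrite !inE /= => /andP[-> ->]; rewrite tA eqxx !andbT.
      by apply: contra tr => /eqP[_ ->].
    rewrite -[m in LHS](subrK (fdim t)).
    transitivity (betti (fun s s' => inc s' s) (fun s => - fdim s)
      (star [set s : {set V} | s \subset t] rho) (m - fdim t)).
      apply: (betti_reindex (e := fun=> 1) (e' := fun=> 1)).
      - by move=> s s' _ _ [].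
      - by move=> s _; rewrite /pair_dim /=; lia.
      - by move=> *; apply: oner_neq0.
      - by move=> *; apply: oner_neq0.
      - move=> s s' _ _; rewrite /pair_diff /tensor_diff /= eqxx.
        have [->|/incidence_fdim] := eqVneq (inc t t) 0; last by lia.
        by rewrite !mulr0 addr0 !mul1r.
    rewrite -[X in betti _ _ _ X]opprK betti_dual betti_interval //.
    by rewrite properEneq eq_sym tr rt.
  suff -> : [set x in finite_pairs :\: Z | x.2 == Some t] = set0.
    exact: betti_set0.
  apply/setP=> -[s t']; rewrite in_set0 inE /=; apply: contraNF tN.
  case/andP=> /setDP[+ sZ] /eqP tE; rewrite tE in sZ *.
  rewrite !inE /= => /andP[/and3P[rs tA st] _].
  rewrite tA (subset_trans rs st) andbT; apply: contra sZ => /eqP tr.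
  by rewrite tr in st *; rewrite !inE xpair_eqE eqxx andbT eqEsubset st rs.
rewrite (betti_open0 cF ZF DZ) ?U0 // betti_set1 /pair_dim /= subrr.
by [].
Qed.

Lemma fdim_rho_lt : fdim rho < d%:Z.
Proof.
rewrite lt_neqAle (fdim_face_le npm (subA rhoA)) andbT.
apply: contraTneq rhoB => dr; apply: topAB rhoA.
by rewrite facetsE subA // dr eqxx.
Qed.

(** The finite pairs have homology in degree 0 only, so all pairs and the row of [None] agree in
    degree [d + 1 - m] unless it is 0 or 1; these are the excluded values of [m]. *)
Lemma betti_open_star m : m != d%:Z -> m != d%:Z + 1 ->
  bt open_star m = bt (star (faces CA) rho) (d%:Z + 1 - m + fdim rho).
Proof.
move=> md md1; rewrite -betti_pairs_columns.
have := betti_les pairs_complex FX DF (d%:Z + 1 - m).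
have := crank_le_closed pairs_complex FX DF (d%:Z + 1 - m).
have := crank_le_closed pairs_complex FX DF (d%:Z + 1 - m - 1).
rewrite subrK !betti_finite_pairs betti_infinite_pairs.
have -> : (d%:Z + 1 - m - 1 == 0) = false by apply/negbTE; lia.
have -> : (d%:Z + 1 - m == 0) = false by apply/negbTE; lia.
by rewrite opprD addNKr opprK; lia.
Qed.

Lemma betti_star_base (X : simplicial_complex V) F :
  F \in faces X -> rho \proper F -> bt (star (faces X) rho) (fdim rho) = 0%N.
Proof.
move=> FX' /properP[rF [v vF vr]].
have rX := faces_closed FX' rF.
have vrX : v |: rho \in faces X.
  by apply: faces_closed FX' _; rewrite subUset sub1set vF.
have l1 : (#|lev dim_ (star (faces X) rho) (fdim rho)| <= 1)%N.
  rewrite -(cards1 rho); apply/subset_leq_card/subsetP=> t.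
  rewrite in_lev in_star in_set1 eq_sym => /andP[/andP[_ rt] /eqP dt].
  by rewrite [rho](fdim_eq_subset rt) ?dt.
have : (0 < brank inc dim_ (star (faces X) rho) (fdim rho + 1))%N.
  rewrite -brank_succ; apply: (rank_smx_gt0 (x := v |: rho) (y := rho)).
  - by rewrite in_lev in_star vrX subsetUr fdim_setU1 // eqxx.
  - by rewrite in_lev in_star rX subxx eqxx.
  - exact: incidence_setU1_neq0.
by rewrite /betti; lia.
Qed.

(** The extra dimension kills the class of the finite pairs: all pairs together have no homology in
    degree 0, so this class is hit by the connecting map from degree 1, which is degree [d] of the
    open star. *)
Lemma betti_open_star_top :
  bt open_star d%:Z = (bt (star (faces CA) rho) (fdim rho + 1)).+1.
Proof.
have := betti_les pairs_complex FX DF 0.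
have := betti_les pairs_complex FX DF 1.
have := crank_le_closed pairs_complex FX DF (-1).
have := crank_le_closed pairs_complex FX DF 1.
rewrite !betti_finite_pairs !betti_infinite_pairs !betti_pairs_columns /=.
rewrite addNr !add0r addrK [1 + fdim rho]addrC.
have [F + FA] := pureA rhoA; rewrite in_tops => /and3P[_ /eqP dF rF].
rewrite (betti_star_base FA); last first.
  rewrite properEneq rF andbT; apply: contraTneq fdim_rho_lt => ->.
  by rewrite dF ltxx.
suff -> : bt open_star (d%:Z + 1 - 0) = 0%N.
  rewrite !leqn0 => /eqP -> /eqP -> + c1; rewrite !addn0 add0n in c1 *.
  by rewrite c1 => <-; exact: addn1.
rewrite subr0 /betti (_ : lev _ _ _ = set0) ?cards0 //.
apply/setP=> t; rewrite in_lev in_setD in_star in_set0.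
apply/negP => /andP[/and3P[_ tC _] /eqP dt].
by have := fdim_face_le npm tC; lia.
Qed.

(** * The pair of stars in [C] and [CB] *)

Let star_split : star (faces C) rho :\: star (faces CB) rho = open_star.
Proof.
by apply/setP=> t; rewrite !inE; case: (rho \subset t); rewrite ?andbT ?andbF.
Qed.

Let starC_complex : is_complex inc dim_ (star (faces C) rho).
Proof. by apply/incidence_complex/convex_star/convex_complex. Qed.

Let starB_sub : star (faces CB) rho \subset star (faces C) rho.
Proof.
by apply/subsetP=> t; rewrite !in_star => /andP[/subB -> ->].
Qed.

Let starB_closed x y : x \in star (faces CB) rho ->
  y \in star (faces C) rho :\: star (faces CB) rho -> inc x y = 0.
Proof.
rewrite star_split !inE => /andP[xB _] /and3P[yB _ _].
apply/eqP; apply: contraNT yB => /incidence_subset; exact: faces_closed.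
Qed.

Definition connecting_rank m :=
  crank inc dim_ (star (faces C) rho) (star (faces CB) rho) m.

Lemma connecting_rank_le_open m : (connecting_rank m <= bt open_star m)%N.
Proof.
by rewrite -star_split; apply: crank_le_open starC_complex starB_sub starB_closed _.
Qed.

Lemma connecting_rank_le_closed m :
  (connecting_rank (m + 1) <= bt (star (faces CB) rho) m)%N.
Proof.
exact: crank_le_closed starC_complex starB_sub starB_closed _.
Qed.

Lemma betti_star_les m :
  (bt (star (faces C) rho) m + connecting_rank m + connecting_rank (m + 1) =
     bt open_star m + bt (star (faces CB) rho) m)%N.
Proof.
by rewrite -star_split; apply: betti_les starC_complex starB_sub starB_closed _.
Qed.

Lemma betti_starB_top : bt (star (faces CB) rho) d%:Z = 0%N.
Proof.
have [F Fs FA] := pureA rhoA.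
apply: (betti_star_top subB (subA rhoA) Fs).
exact: topAB (tops_facet Fs) FA.
Qed.

(** One top class of the pair comes from the single top class in [C]; the others inject under the
    connecting map, and [CB] has no top class. *)
Lemma connecting_rank_top : connecting_rank d%:Z = (bt open_star d%:Z).-1.
Proof.
have := betti_star_les d%:Z; have := connecting_rank_le_closed d%:Z.
by rewrite betti_starB_top betti_star_top_eq1 ?subA // leqn0 => /eqP ->; lia.
Qed.

(** For nonempty [rho] the star in [CA] is acyclic, so up to degree [d] the pair has one class,
    which comes from [C] in degree [d]; no connecting map is left there. *)
Lemma betti_starB m : rho != set0 -> m < d%:Z ->
  bt (star (faces CB) rho) m = bt (star (faces C) rho) m.
Proof.
move=> rho0 md; have A0 n := betti_starA_eq0 n rhoA rhoB rho0.
have cr0 n : n <= d%:Z -> connecting_rank n = 0%N.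
  rewrite le_eqVlt => /orP[/eqP ->|nd].
    by rewrite connecting_rank_top betti_open_star_top A0.
  apply/eqP; rewrite -leqn0 (leq_trans (connecting_rank_le_open n)) //.
  by rewrite betti_open_star ?A0 //; lia.
have := betti_star_les m; rewrite !cr0 ?betti_open_star ?A0 ?addn0 //; lia.
Qed.

End Duality.

(** * The exact sequence *)

Lemma cdim_link (V : finType) (d : nat) (X : simplicial_complex V)
    (s F : {set V}) :
  (forall t, t \in faces X -> fdim t <= d%:Z) ->
  F \in faces X -> fdim F = d%:Z -> s \subset F ->
  cdim (link X s) = d%:Z - #|s|%:Z.
Proof.
move=> dX FX dF sF; rewrite /cdim.
have cF : #|F| = d.+1 by move: dF; rewrite /fdim; lia.
suff -> : (\max_(t in faces (link X s)) #|t|)%N = (#|F| - #|s|)%N.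
  by have := subset_leq_card sF; rewrite cF; lia.
have cFs : #|F :\: s| = (#|F| - #|s|)%N by rewrite cardsD (setIidPr sF).
apply/eqP; rewrite eqn_leq; apply/andP; split.
  apply/bigmax_leqP => t; rewrite inE => /and3P[_ /dX].
  by rewrite /fdim cardsU => dt /eqP ts; move: dt; rewrite ts cards0 cF; lia.
rewrite -cFs; apply: leq_bigmax_cond.
have : F \in star (faces X) s by rewrite in_star FX.
rewrite -link_star => /imsetP[t tl FE].
suff -> : F :\: s = t by [].
have := link_disjoint tl; rewrite FE setDUl setDv setU0 disjoint_sym.
by move/setDidPl.
Qed.

Section SameBetti.

Variables (K : fieldType) (V : finType) (X Y : simplicial_complex V) (i j : int).

Lemma shift_mxK n m (u : 'rV[K]_n) : (n <= m)%N ->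
  u *m shift_mx K 0 n m *m shift_mx K 0 m n = u.
Proof.
move=> nm; apply/rowP=> l; have lm := leq_trans (ltn_ord l) nm.
rewrite mul_shift_mx add0n (insubT (fun x => x < m)%N lm) /=.
rewrite mul_shift_mx /= add0n (insubT (fun x => x < n)%N (ltn_ord l)) /=.
by congr (u _ _); apply: val_inj.
Qed.

Lemma redcoH_isomorphic : rbetti K X i = rbetti K Y j ->
  lin_isomorphic (redcoH K X i) (redcoH K Y j).
Proof.
move=> XY; have nm : redcoH_dim K X i = redcoH_dim K Y j by rewrite !redcoH_dimE.
exists (redcoH_vec K Y j \o
  mulmxr (shift_mx K 0 (redcoH_dim K X i) (redcoH_dim K Y j))
  \o redcoH_coord K X i).
exists (redcoH_vec K X i \o
  mulmxr (shift_mx K 0 (redcoH_dim K Y j) (redcoH_dim K X i))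
  \o redcoH_coord K Y j) => x /=.
  by rewrite redcoH_vecK shift_mxK ?nm // redcoH_coordK.
by rewrite redcoH_vecK shift_mxK ?nm // redcoH_coordK.
Qed.

End SameBetti.

Lemma exact_conj (K : fieldType) (X Y Z : lmodType K) n m p
    (fX : {linear X -> 'rV[K]_n}) (gX : {linear 'rV[K]_n -> X})
    (fY : {linear Y -> 'rV[K]_m}) (gY : {linear 'rV[K]_m -> Y})
    (fZ : {linear Z -> 'rV[K]_p}) (gZ : {linear 'rV[K]_p -> Z})
    (M : 'M_(n, m)) (N : 'M_(m, p)) :
  cancel gX fX -> cancel fY gY -> cancel gY fY -> cancel gZ fZ ->
  (forall u : 'rV_m, u *m N = 0 <-> exists v : 'rV_n, v *m M = u) ->
  exact (gY \o mulmxr M \o fX) (gZ \o mulmxr N \o fY).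
Proof.
move=> gfX fgY gfY gfZ MN y /=; split=> [gz0|[x <-]]; last first.
  by rewrite gfY (MN _).2 ?linear0 //; exists (fX x).
have /MN[v vM] : fY y *m N = 0 by apply: (can_inj gfZ); rewrite gz0 linear0.
by exists (gX v); rewrite gfX vM fgY.
Qed.

(* Over a field only the dimensions matter: r j plays the role of the rank of
   the map from HB j to HA j. *)
Lemma exact_sequence_of_ranks (K : fieldType) (d : nat)
    (HA HB HC : nat -> lmodType K) (a b c r : nat -> nat)
    (fA : forall j, {linear HA j -> 'rV[K]_(a j)})
    (gA : forall j, {linear 'rV[K]_(a j) -> HA j})
    (fB : forall j, {linear HB j -> 'rV[K]_(b j)})
    (gB : forall j, {linear 'rV[K]_(b j) -> HB j})
    (fC : forall j, {linear HC j -> 'rV[K]_(c j)})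
    (gC : forall j, {linear 'rV[K]_(c j) -> HC j}) :
  (forall j, cancel (fA j) (gA j)) -> (forall j, cancel (gA j) (fA j)) ->
  (forall j, cancel (fB j) (gB j)) -> (forall j, cancel (gB j) (fB j)) ->
  (forall j, cancel (fC j) (gC j)) -> (forall j, cancel (gC j) (fC j)) ->
  (0 < d)%N -> r 0%N = b 0%N ->
  (forall j, (j < d)%N -> (r j <= b j)%N) ->
  (forall j, (j < d)%N -> (r j <= a j)%N) ->
  (forall j, (j.+1 < d)%N -> (c j.+1 + r j + r j.+1 = a j + b j.+1)%N) ->
  r d.-1 = a d.-1 ->
  exists (alpha : forall j : nat, {linear HB j -> HA j})
    (beta : forall j : nat, {linear HA j -> HC j.+1})
    (gamma : forall j : nat, {linear HC j -> HB j}),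
  [/\ injective (alpha 0%N),
      forall j : nat, (j.+1 < d)%N ->
        [/\ exact (alpha j) (beta j), exact (beta j) (gamma j.+1)
          & exact (gamma j.+1) (alpha j.+1)]
    & forall y, exists x, alpha d.-1 x = y].
Proof.
move=> fgA gfA fgB gfB fgC gfC d_gt0 r0 rB rA rC rT.
(* The map [alpha j] has rank [r j], so it kills [b j - r j] coordinates. Each later map kills the
   image of the previous one, of dimension [r j] for [beta j] and [a j - r j] for [gamma j.+1]. *)
exists (fun j => gA j \o mulmxr (shift_mx K (b j - r j) (b j) (a j)) \o fB j).
exists (fun j => gC j.+1 \o mulmxr (shift_mx K (r j) (a j) (c j.+1)) \o fA j).
exists (fun j => gB j \o mulmxr (shift_mx K (a j.-1 - r j.-1) (c j) (b j)) \o fC j).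
split=> [x y|j jd|y].
- move/(can_inj (gfA 0%N)) => /= xy; apply: (can_inj (fgB 0%N)).
  have ba : (b 0 <= a 0)%N by rewrite -r0 rA.
  by apply: (shift_mx_inj _ ba) xy; rewrite r0 subnn.
- have rBj := rB _ (ltnW jd); have rAj := rA _ (ltnW jd).
  have rBj1 := rB _ jd; have rAj1 := rA _ jd; have rCj := rC _ jd.
  split.
  + by apply: (exact_conj (gX := gB j)) => //; apply: shift_mx_exact; lia.
  + by apply: (exact_conj (gX := gA j)) => //; apply: shift_mx_exact => /=; lia.
  + by apply: (exact_conj (gX := gC j.+1)) => //; apply: shift_mx_exact => /=; lia.
have le_ab : (a d.-1 <= b d.-1 - (b d.-1 - r d.-1))%N.
  by have := rB d.-1; rewrite -rT prednK // leqnn => /(_ isT); lia.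
have [u uE] := shift_mx_surj le_ab (fA d.-1 y).
by exists (gB d.-1 u) => /=; rewrite gfB uE fgA.
Qed.

(** * Specialisation to the empty face and to links *)

Section MainTheorem.

Variables (k : fieldType) (V : finType) (d : nat).
Variables (C CA CB : simplicial_complex V).
Hypothesis d1 : (1 <= d)%N.
Hypothesis npm : normal_pseudomanifold d C.
Hypothesis top_nz : rbetti k C d%:Z != 0%N.
Local Notation tops s := (lev (@fdim V) (star (faces C) s) d%:Z).
Hypothesis CAB : forall s, (s \in faces C) = (s \in faces CA) || (s \in faces CB).
Hypothesis pureA : forall s, s \in faces CA ->
  exists2 F, F \in tops s & F \in faces CA.
Hypothesis pureB : forall s, s \in faces CB ->
  exists2 F, F \in tops s & F \in faces CB.
Hypothesis topAB : forall F, F \in facets C -> F \in faces CA -> F \notin faces CB.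
Hypothesis A0 : set0 \in faces CA.
Hypothesis B0 : set0 \in faces CB.
Hypothesis buchs : buchsbaum k CA.

(** Purity of [CA] gives the link dimension [d - #|s|], so after the shift from link to star the
    bound on the degree becomes [m < d]. *)
Lemma buchsbaum_star s m : s \in faces CA -> s != set0 -> m < d%:Z ->
  betti (incidence k) (@fdim V) (star (faces CA) s) m = 0%N.
Proof.
move=> sA s0 md; have [F + FA] := pureA sA; rewrite in_tops => /and3P[_ /eqP dF sF].
have dX t : t \in faces CA -> fdim t <= d%:Z.
  by move=> tA; apply: (fdim_face_le npm); rewrite CAB tA.
have := buchs sA s0 (i := m - #|s|%:Z); rewrite (cdim_link dX FA dF sF).
rewrite ltrD2r => /(_ md) /redH_eq0P.
by rewrite /rbetti betti_link subrK.
Qed.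

(** With [rho] empty, [r j] is the connecting rank in degree [j + 1]; the dimension -1 of the empty
    face turns the duality into degree [d - 1 - j] for [CA]. *)
Lemma connecting_numbers : exists r : nat -> nat,
  [/\ r 0%N = rbetti k CB 0,
      forall j, (j < d)%N -> (r j <= rbetti k CB j%:Z)%N,
      forall j, (j < d)%N -> (r j <= rbetti k CA (d%:Z - 1 - j%:Z)%R)%N,
      forall j, (j.+1 < d)%N ->
        (rbetti k C j.+1%:Z + r j + r j.+1 =
         rbetti k CA (d%:Z - 1 - j%:Z)%R + rbetti k CB j.+1%:Z)%N
    & r d.-1 = rbetti k CA (d%:Z - 1 - d.-1%:Z)].
Proof.
have [mu [mu0 muC]] := fundamental_cycle npm top_nz.
pose cr := connecting_rank k C CB set0.
have open_le (m : int) :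
    (cr m <= betti (incidence k) (@fdim V) (open_star C CB set0) m)%N.
  exact: (connecting_rank_le_open k CAB).
have closed_le (m : int) : (cr (m + 1)%R <= rbetti k CB m)%N.
  by have := connecting_rank_le_closed k CAB set0 m; rewrite star0.
have les (m : int) : (rbetti k C m + cr m + cr (m + 1)%R =
    betti (incidence k) (@fdim V) (open_star C CB set0) m + rbetti k CB m)%N.
  by have := betti_star_les k CAB set0 m; rewrite !star0.
have fdim0 : fdim (set0 : {set V}) = -1 by rewrite /fdim cards0.
have openE j : (j.+1 < d)%N ->
    betti (incidence k) (@fdim V) (open_star C CB set0) j.+1%:Z =
    rbetti k CA (d%:Z - 1 - j%:Z).
  move=> jd; rewrite (betti_open_star npm CAB pureB topAB buchsbaum_star mu0 muC A0 B0).
  - by rewrite star0 fdim0; congr (rbetti k CA _); lia.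
  - by apply/eqP; lia.
  - by apply/eqP; lia.
have openT : betti (incidence k) (@fdim V) (open_star C CB set0) d%:Z =
    (rbetti k CA 0).+1.
  rewrite (betti_open_star_top npm CAB pureA pureB topAB buchsbaum_star mu0 muC A0 B0).
  by rewrite star0 fdim0.
have crT : cr d%:Z = rbetti k CA 0.
  have := connecting_rank_top npm CAB pureA topAB mu0 muC A0 B0.
  by rewrite openT.
have dE : d%:Z - 1 - d.-1%:Z = 0 by lia.
exists (fun j => cr j.+1%:Z); split.
(* Since [C] is connected, nothing in degree 0 of [CB] comes from [C], and the count forces the
   connecting rank to be everything. *)
- have c1 : (cr 1%:Z <= rbetti k CB 0)%N by apply: (closed_le 0).
  have := les 0; rewrite (betti0_eq0 k npm d1) add0n -[0 + 1]/(1%:Z) => les0.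
  apply/eqP; rewrite eqn_leq c1 -(leq_add2l (cr 0)) les0 leq_add2r.
  exact: open_le.
- by move=> j jd; have := closed_le j%:Z; rewrite -PoszD addn1.
(* For [j = d - 1] the pair has one class more than [CA], so the bound is taken from the connecting
   rank itself. *)
- move=> j jd; have [jd'|jd'] := ltnP j.+1 d; first by rewrite -openE // open_le.
  have -> : d%:Z - 1 - j%:Z = 0 by lia.
  have -> : j.+1 = d by lia.
  by rewrite crT.
- move=> j jd; rewrite -openE // -les.
  by rewrite -PoszD addn1.
- by rewrite dE prednK.
Qed.

Lemma exact_sequence : exists
    (alpha : forall j : nat,
       {linear redcoH k CB j%:Z -> redH k CA (d%:Z - 1 - j%:Z)})
    (beta : forall j : nat,
       {linear redH k CA (d%:Z - 1 - j%:Z) -> redcoH k C j.+1%:Z})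
    (gamma : forall j : nat, {linear redcoH k C j%:Z -> redcoH k CB j%:Z}),
  [/\ injective (alpha 0%N),
      forall j : nat, (j.+1 < d)%N ->
        [/\ exact (alpha j) (beta j), exact (beta j) (gamma j.+1)
          & exact (gamma j.+1) (alpha j.+1)]
    & forall y, exists x, alpha d.-1 x = y].
Proof.
have [r [r0 rB rA rC rT]] := connecting_numbers.
apply: (exact_sequence_of_ranks (r := r)
  (HA := fun j => redH k CA (d%:Z - 1 - j%:Z))
  (HB := fun j => redcoH k CB j%:Z) (HC := fun j => redcoH k C j%:Z)
  (fun j => @redH_coordK k V CA (d%:Z - 1 - j%:Z))
  (fun j => @redH_vecK k V CA (d%:Z - 1 - j%:Z))
  (fun j => @redcoH_coordK k V CB j%:Z) (fun j => @redcoH_vecK k V CB j%:Z)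
  (fun j => @redcoH_coordK k V C j%:Z) (fun j => @redcoH_vecK k V C j%:Z)) => //.
- by rewrite redcoH_dimE.
- by move=> j; rewrite redcoH_dimE; apply: rB.
- by move=> j; rewrite redH_dimE; apply: rA.
- by move=> j; rewrite redH_dimE !redcoH_dimE; apply: rC.
- by rewrite redH_dimE.
Qed.

(** Outside [CB] the star in [CB] is void and the one in [C] is that in [CA], acyclic below [d].
    Outside [CA] the two stars coincide. For a common face the duality applies with [rho] equal to
    [s]. *)
Lemma betti_link_star s m : s \in faces C -> s != set0 -> m < d%:Z ->
  betti (incidence k) (@fdim V) (star (faces CB) s) m =
  betti (incidence k) (@fdim V) (star (faces C) s) m.
Proof.
have [mu [mu0 muC]] := fundamental_cycle npm top_nz.
move=> sC s0 md; have [sB|sB] := boolP (s \in faces CB); last first.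
  have sA : s \in faces CA by move: sC; rewrite CAB (negPf sB) orbF.
  have notB (t : {set V}) : s \subset t -> (t \in faces CB) = false.
    by move=> st; apply: contraNF sB => tB; apply: faces_closed tB st.
  have -> : star (faces CB) s = set0.
    apply/setP=> t; rewrite in_star in_set0.
    by case: (boolP (s \subset t)) => [/notB -> | _]; rewrite ?andbF.
  have -> : star (faces C) s = star (faces CA) s.
    apply/setP=> t; rewrite !in_star CAB.
    by case: (boolP (s \subset t)) => [/notB -> | _]; rewrite ?orbF ?andbF.
  by rewrite betti_set0 buchsbaum_star.
have [sA|sA] := boolP (s \in faces CA).
  exact: (betti_starB npm CAB pureA pureB topAB buchsbaum_star mu0 muC sA sB).
suff -> : star (faces CB) s = star (faces C) s by [].
apply/setP=> t; rewrite !in_star CAB.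
case: (boolP (s \subset t)) => st; last by rewrite !andbF.
have /negPf -> // : t \notin faces CA.
by apply: contra sA => tA; apply: faces_closed tA st.
Qed.

Lemma link_facts s : s \in faces C -> s != set0 ->
  cdim (link C s) = d%:Z - #|s|%:Z /\
  forall i : int, i < cdim (link C s) ->
    lin_isomorphic (redcoH k (link CB s) i) (redcoH k (link C s) i).
Proof.
move=> sC s0; have [F] := face_in_top npm sC.
rewrite in_tops => /and3P[FC /eqP dF sF].
rewrite (cdim_link (fdim_face_le npm) FC dF sF); split=> // i id.
apply: redcoH_isomorphic; rewrite /rbetti !betti_link betti_link_star //.
by move: id; rewrite ltrBrDr.
Qed.

Lemma link_vanishing s : s \in faces C -> s \notin faces CB ->
  forall i : int, i < cdim (link C s) -> forall x : redcoH k (link C s) i, x = 0.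
Proof.
move=> sC sB i; have s0 : s != set0 by apply: contraNneq sB => ->.
have [-> _] := link_facts sC s0; rewrite ltrBrDr => id.
apply/redcoH_eq0P; rewrite /rbetti betti_link -betti_link_star //.
suff -> : star (faces CB) s = set0 by apply: betti_set0.
apply/setP=> t; rewrite in_star in_set0; apply: contraNF sB => /andP[tB].
exact: faces_closed tB.
Qed.

End MainTheorem.

Theorem theorem4p7 (k : fieldType) (V : finType) (d : nat)
    (Delta : simplicial_complex V) (l : nat) (sigma : 'I_l -> {set V})
    (A B : {set 'I_l}) :
  (1 <= d)%N ->
  normal_pseudomanifold d Delta ->
  (exists x : redcoH k Delta d%:Z, x != 0) ->
  injective sigma ->
  [set sigma i | i : 'I_l] = facets Delta ->
  A :|: B = [set: 'I_l] -> A :&: B = set0 -> A != set0 -> B != set0 ->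
  let DeltaA := generated_complex [set sigma i | i in A] in
  let DeltaB := generated_complex [set sigma i | i in B] in
  buchsbaum k DeltaA ->
  [/\ exists (alpha : forall j : nat,
                {linear redcoH k DeltaB j%:Z ->
                        redH k DeltaA (d%:Z - 1 - j%:Z)})
             (beta : forall j : nat,
                {linear redH k DeltaA (d%:Z - 1 - j%:Z) ->
                        redcoH k Delta j.+1%:Z})
             (gamma : forall j : nat,
                {linear redcoH k Delta j%:Z -> redcoH k DeltaB j%:Z}),
        [/\ injective (alpha 0%N),
            forall j : nat, (j.+1 < d)%N ->
              [/\ exact (alpha j) (beta j),
                  exact (beta j) (gamma j.+1)
                & exact (gamma j.+1) (alpha j.+1)]
          & forall y, exists x, alpha d.-1 x = y],
      forall s : {set V}, s \in faces Delta -> s != set0 ->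
        cdim (link Delta s) = d%:Z - #|s|%:Z /\
        forall i : int, i < cdim (link Delta s) ->
          lin_isomorphic (redcoH k (link DeltaB s) i)
                         (redcoH k (link Delta s) i)
    & forall s : {set V}, s \in faces Delta -> s \notin faces DeltaB ->
        forall i : int, i < cdim (link Delta s) ->
        forall x : redcoH k (link Delta s) i, x = 0].
Proof.
move=> d1 npm [x0 x0_neq0] sigmaI sigmaE AB AIB A_neq0 B_neq0 DeltaA DeltaB buchs.
have top_nz : rbetti k Delta d%:Z != 0%N.
  by apply: contraNneq x0_neq0 => /redcoH_eq0P H0; apply/eqP/H0.
have genP (X : {set 'I_l}) (s : {set V}) : reflect (exists2 i, i \in X & s \subset sigma i)
    (s \in faces (generated_complex [set sigma i | i in X])).
  rewrite inE; apply: (iffP exists_inP) => [[_ /imsetP[i iX ->] si]|[i iX si]].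
    by exists i.
  by exists (sigma i); rewrite ?imset_f.
have sigmaF i : sigma i \in facets Delta by rewrite -sigmaE imset_f.
have gen_sub (X : {set 'I_l}) (s : {set V}) :
    s \in faces (generated_complex [set sigma i | i in X]) -> s \in faces Delta.
  case/genP=> i _ si; apply: faces_closed si.
  by have := sigmaF i; rewrite inE => /andP[].
have pure (X : {set 'I_l}) (s : {set V}) :
    s \in faces (generated_complex [set sigma i | i in X]) ->
    exists2 F, F \in lev (@fdim V) (star (faces Delta) s) d%:Z &
      F \in faces (generated_complex [set sigma i | i in X]).
  case/genP=> i iX si; exists (sigma i); last by apply/genP; exists i.
  by rewrite in_tops si andbT; have := sigmaF i; rewrite (facetsE npm).
have CAB (s : {set V}) :
    (s \in faces Delta) = (s \in faces DeltaA) || (s \in faces DeltaB).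
  apply/idP/orP => [sC|[] /gen_sub //].
  have [F] := face_in_facet sC; rewrite -sigmaE => /imsetP[i _ ->] si.
  have : i \in A :|: B by rewrite AB in_setT.
  by case/setUP=> iX; [left | right]; apply/genP; exists i.
have facet_eq (F : {set V}) i :
    F \in facets Delta -> F \subset sigma i -> F = sigma i.
  rewrite (facetsE npm) => /andP[_ /eqP dF] Fi; apply: fdim_eq_subset Fi _.
  by have := sigmaF i; rewrite (facetsE npm) dF => /andP[_ /eqP ->].
(* A facet inside [sigma i] equals it, as all facets have dimension [d]; injectivity of [sigma] then
   turns a common facet into a common index. *)
have topAB (F : {set V}) :
    F \in facets Delta -> F \in faces DeltaA -> F \notin faces DeltaB.
  move=> FC /genP[i iA Fi]; apply/genP => -[j jB Fj].
  have ij : i = j by apply: sigmaI; rewrite -(facet_eq F i) // -(facet_eq F j).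
  have : i \in A :&: B by rewrite inE iA ij.
  by rewrite AIB in_set0.
(* Both parts being nonempty, the empty face is common and may serve as [rho]. *)
have set0_in (X : {set 'I_l}) : X != set0 ->
    set0 \in faces (generated_complex [set sigma i | i in X]).
  by case/set0Pn=> i iX; apply/genP; exists i; rewrite ?sub0set.
have [A0 B0] := (set0_in A A_neq0, set0_in B B_neq0).
split.
- exact: (exact_sequence d1 npm top_nz CAB (pure A) (pure B) topAB A0 B0 buchs).
- exact: (link_facts npm top_nz CAB (pure A) (pure B) topAB buchs).
- exact: (link_vanishing npm top_nz CAB (pure A) (pure B) topAB B0 buchs).
Qed.
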